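(* Let $\lambda/\mu$ be a skew shape (partitions $\mu\subseteq\lambda$). Then $$\sum_{\pi\in \mathrm{RPP}(\lambda/\mu)} q^{|\pi|}\,t^{\mathrm{tr}(\pi)}\;=\;\sum_{S\in\mathcal{P}(\lambda/\mu)}\ \prod_{u\in S\cap\square^\lambda}\frac{t\,q^{h(u)}}{1-t\,q^{h(u)}}\ \prod_{u\in S\setminus\square^\lambda}\frac{q^{h(u)}}{1-q^{h(u)}},$$ where $\mathcal{P}(\lambda/\mu)$ is the set of pleasant diagrams of $\lambda/\mu$ and $\square^\lambda$ is the Durfee square of $\lambda$.
   Context: $[\lambda]=\{(i,j):1\le i\le \ell(\lambda),\,1\le j\le\lambda_i\}$ is the Young diagram (rows numbered from the top, columns from the left), $\lambda'$ is the conjugate partition, and $h(i,j)=\lambda_i-i+\lambda'_j-j+1$ is the hook-length in $\lambda$. The Durfee square $\square^\lambda$ is the largest square $\{(i,j):1\le i,j\le k\}$ contained in $[\lambda]$. $\mathrm{RPP}(\lambda/\mu)$ is the set of reverse plane partitions of shape $\lambda/\mu$: fillings $\pi$ of the cells of $[\lambda]\setminus[\mu]$ with nonnegative integers, weakly increasing along rows and down columns; $|\pi|$ is the sum of the entries and $\mathrm{tr}(\pi)=\sum_i\pi_{i,i}$ (sum over diagonal cells $(i,i)$ of $[\lambda]\setminus[\mu]$). Pleasant diagrams: for an integer $k$ with $1-\ell(\lambda)\le k\le\lambda_1-1$, let $\mathsf{d}_k=\{(i,j)\in[\lambda]\setminus[\mu]: j-i=k\}$, let $s_k=|\mathsf{d}_k|$,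 and let $\square_k^\lambda$ be the largest rectangle with $i$ rows and $i+k$ columns, with northwest corner $(1,1)$, that fits inside $[\lambda]$. A descending chain of length $s$ in a set of cells is a sequence of cells $(i_1,j_1),\ldots,(i_s,j_s)$ of the set with $i_1<\cdots<i_s$ and $j_1<\cdots<j_s$. A subset $S\subseteq[\lambda]$ is a pleasant diagram of $\lambda/\mu$ if for every $k$ with $1-\ell(\lambda)\le k\le\lambda_1-1$, every descending chain in $S\cap\square_k^\lambda$ has length at most $s_k$. *)

(* Defs.v *)
From HB Require Import structures.
From mathcomp Require Import all_boot all_order all_algebra.
From mathcomp Require Import boolp classical_sets cardinality fsbigop.

Set Implicit Arguments.
Unset Strict Implicit.
Unset Printing Implicit Defensive.

Import Order.TTheory GRing.Theory Num.Theory.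

Local Open Scope ring_scope.

(* Formal power series in one variable. The wrapper keeps [fps R] apart from
   [nat -> R], which MathComp-Analysis equips with pointwise operations. *)

Record fps (R : Type) := Fps { coefs : nat -> R }.

HB.instance Definition _ (R : Type) := gen_eqMixin (fps R).
HB.instance Definition _ (R : Type) := gen_choiceMixin (fps R).

Lemma fpsP (R : Type) (f g : fps R) :
  (forall n, coefs f n = coefs g n) -> f = g.
Proof. by case: f g => [f] [g] /= fg; congr Fps; apply/funext. Qed.

Section FpsRing.
Variable R : comNzRingType.
Implicit Types f g h : fps R.

Definition fps_zero : fps R := Fps (fun _ => 0).
Definition fps_opp f : fps R := Fps (fun n => - coefs f n).
Definition fps_add f g : fps R := Fps (fun n => coefs f n + coefs g n).
Definition fpsC (c : R) : fps R := Fps (fun n => if n == 0%N then c else 0).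
Definition fpsX : fps R := Fps (fun n => (n == 1%N)%:R).
Definition fps_mul f g : fps R :=
  Fps (fun n => \sum_(i < n.+1) coefs f i * coefs g (n - i)).

Fact fps_addA : associative fps_add.
Proof. by move=> f g h; apply: fpsP => n; apply: addrA. Qed.
Fact fps_addC : commutative fps_add.
Proof. by move=> f g; apply: fpsP => n; apply: addrC. Qed.
Fact fps_add0 : left_id fps_zero fps_add.
Proof. by move=> f; apply: fpsP => n; apply: add0r. Qed.
Fact fps_addN : left_inverse fps_zero fps_opp fps_add.
Proof. by move=> f; apply: fpsP => n; apply: addNr. Qed.

HB.instance Definition _ :=
  GRing.isZmodule.Build (fps R) fps_addA fps_addC fps_add0 fps_addN.

Definition fps_trunc n f : {poly R} := \poly_(i < n) coefs f i.

Lemma coef_fps_mul n m f g : (m < n)%N ->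
  coefs (fps_mul f g) m = (fps_trunc n f * fps_trunc n g)`_m.
Proof.
move=> ltmn; rewrite coefM; apply: eq_bigr => i _.
rewrite !coef_poly (leq_ltn_trans _ ltmn) ?leq_ord //.
by rewrite (leq_ltn_trans _ ltmn) ?leq_subr.
Qed.

Fact fps_mulA : associative fps_mul.
Proof.
move=> f g h; apply: fpsP => n.
transitivity (fps_trunc n.+1 f * (fps_trunc n.+1 g * fps_trunc n.+1 h))`_n.
  rewrite coefM; apply: eq_bigr => i _.
  by rewrite coef_poly ltn_ord -coef_fps_mul // ltnS leq_subr.
rewrite mulrA coefM; apply: eq_bigr => i _.
by rewrite -coef_fps_mul // coef_poly ltnS leq_subr.
Qed.

Fact fps_mulC : commutative fps_mul.
Proof.
by move=> f g; apply: fpsP => n; rewrite !(@coef_fps_mul n.+1) // mulrC.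
Qed.

Fact fps_mul1 : left_id (fpsC 1) fps_mul.
Proof.
move=> f; apply: fpsP => n /=; rewrite big_ord_recl /= mul1r subn0.
by rewrite big1 ?addr0 // => i _; rewrite mul0r.
Qed.

Fact fps_mulDl : left_distributive fps_mul fps_add.
Proof.
move=> f g h; apply: fpsP => n /=; rewrite -big_split /=.
by apply: eq_bigr => i _; rewrite mulrDl.
Qed.

Fact fps_oner_neq0 : fpsC 1 != 0 :> fps R.
Proof.
by apply/eqP => /(congr1 (fun f => coefs f 0)) /= /eqP; rewrite oner_eq0.
Qed.

HB.instance Definition _ := GRing.Zmodule_isComNzRing.Build (fps R)
  fps_mulA fps_mulC fps_mul1 fps_mulDl fps_oner_neq0.

Lemma coefs0 n : coefs (0 : fps R) n = 0. Proof. by []. Qed.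
Lemma coefs1 n : coefs (1 : fps R) n = (n == 0%N)%:R.
Proof. by rewrite /=; case: eqP. Qed.
Lemma coefsD f g n : coefs (f + g) n = coefs f n + coefs g n.
Proof. by []. Qed.
Lemma coefsN f n : coefs (- f) n = - coefs f n. Proof. by []. Qed.
Lemma coefsM f g n :
  coefs (f * g) n = \sum_(i < n.+1) coefs f i * coefs g (n - i).
Proof. by []. Qed.
Lemma coefsM0 f g : coefs (f * g) 0 = coefs f 0 * coefs g 0.
Proof. by rewrite coefsM big_ord1. Qed.
Lemma coefsCM c f n : coefs (fpsC c * f) n = c * coefs f n.
Proof.
rewrite coefsM big_ord_recl /= subn0.
by rewrite big1 ?addr0 // => i _; rewrite mul0r.
Qed.
Lemma coefs_sum (I : Type) (r : seq I) (P : pred I) (F : I -> fps R) n :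
  coefs (\sum_(i <- r | P i) F i) n = \sum_(i <- r | P i) coefs (F i) n.
Proof. exact: (big_morph (fun f => coefs f n)). Qed.

Lemma coefs_exp_small f k n : coefs f 0 = 0 -> (n < k)%N ->
  coefs (f ^+ k) n = 0.
Proof.
move=> f0; elim: k n => // k IHk n; rewrite ltnS => le_nk.
rewrite exprS coefsM big1 // => -[[|i] /= lti] _; first by rewrite f0 mul0r.
rewrite IHk ?mulr0 //; apply: leq_trans le_nk.
by rewrite ltn_subrL; case: n lti.
Qed.

End FpsRing.

Section FpsInverse.
Variable R : comUnitRingType.
Implicit Types f g : fps R.

Definition fps_unit : pred (fps R) := fun f => coefs f 0 \is a GRing.unit.

(* Writing [f = f_0 (1 - u)] with [u] without constant term, the inverse is
   [f_0^-1 * \sum_k u ^+ k], where only [k <= n] matters for coefficient [n].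
   As for every [unitRingType], the inverse of a non-unit is itself. *)
Definition fps_inv f : fps R :=
  let u := 1 - fpsC (coefs f 0)^-1 * f in
  if fps_unit f then
    Fps (fun n => (coefs f 0)^-1 * coefs (\sum_(k < n.+1) u ^+ k) n)
  else f.

Fact fps_mulVr : {in fps_unit, left_inverse 1 fps_inv *%R}.
Proof.
move=> f Uf; rewrite /fps_inv ifT //.
set a := (coefs f 0)^-1; set u := 1 - _.
have u0 : coefs u 0 = 0.
  by rewrite /u coefsD coefsN coefsCM coefs1 mulVr ?subrr.
have -> : Fps (fun n => a * coefs (\sum_(k < n.+1) u ^+ k) n)
    = fpsC a * Fps (fun n => coefs (\sum_(k < n.+1) u ^+ k) n).
  by apply: fpsP => n; rewrite coefsCM.
rewrite mulrAC; have -> : fpsC a * f = 1 - u by rewrite /u opprB addrC subrK.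
apply: fpsP => n.
transitivity (coefs ((1 - u) * \sum_(k < n.+1) u ^+ k) n).
  rewrite !coefsM; apply: eq_bigr => i _ /=; congr (_ * _).
  rewrite !coefs_sum.
  rewrite (@big_ord_widen _ _ _ _ n.+1 (fun k => coefs (u ^+ k) (n - i))).
    rewrite big_mkcond; apply: eq_bigr => k _ /=; rewrite ltnS.
    by case: leqP => // lt_nik; rewrite coefs_exp_small.
  by rewrite ltnS leq_subr.
rewrite mulrC -[LHS]opprK -coefsN -mulrN opprB mulrC -subrX1.
by rewrite coefsD coefsN (coefs_exp_small u0) ?ltnSn // sub0r opprK.
Qed.

Fact fps_unitPl f g : g * f = 1 -> fps_unit f.
Proof.
move=> /(congr1 (fun h => coefs h 0)); rewrite coefsM0 coefs1 /= => gf1.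
by apply/unitrPr; exists (coefs g 0); rewrite mulrC.
Qed.

Fact fps_invr_out : {in [predC fps_unit], fps_inv =1 id}.
Proof. by move=> f nUf; rewrite /fps_inv ifN. Qed.

HB.instance Definition _ := GRing.ComNzRing_hasMulInverse.Build (fps R)
  fps_mulVr fps_unitPl fps_invr_out.

End FpsInverse.

(* The ring Z[[q, t]], as power series in q over Z[[t]]. *)

Notation Zqt := (fps (fps int)).

Definition q : Zqt := fpsX _.
Definition t : Zqt := fpsC (fpsX _).

Definition coef_qt (f : Zqt) (n m : nat) : int := coefs (coefs f n) m.

(* [F] is summable with sum [s]: every monomial occurs in finitely many
   members of the family, and its coefficients add up to the one in [s]. *)
Definition has_sum (I : choiceType) (F : I -> Zqt) (s : Zqt) : Prop :=
  forall n m : nat,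
    finite_set [set i | coef_qt (F i) n m != 0]%classic /\
    \sum_(i \in [set: I]%classic) coef_qt (F i) n m = coef_qt s n m.

(* Rows, columns and parts are numbered from 0: the cell [(i, j)] below is the
   cell [(i + 1, j + 1)] in the usual numbering from 1. *)

Definition is_partition (la : seq nat) : bool :=
  sorted geq la && (0%N \notin la).

Definition young (la : seq nat) : pred (nat * nat) :=
  [pred c | (c.1 < size la)%N && (c.2 < nth 0%N la c.1)%N].

Definition included (mu la : seq nat) : Prop :=
  forall c, young mu c -> young la c.

(* Bounding box of the diagram, so that sets of cells can be finite sets. *)
Definition cell (la : seq nat) : finType := ('I_(size la) * 'I_(head 0%N la))%type.

Definition cell_val (la : seq nat) (u : cell la) : nat * nat :=
  (val u.1, val u.2).

Definition diagram (la : seq nat) : {set cell la} :=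
  [set u | young la (cell_val u)].

Definition skew_diagram (la mu : seq nat) : {set cell la} :=
  [set u in diagram la | ~~ young mu (cell_val u)].

(* The part [la'_(j+1)] of the conjugate: number of parts of size >= [j + 1]. *)
Definition conj_part (la : seq nat) (j : nat) : nat :=
  count (fun p => (j < p)%N) la.

(* With 1-based [i], [j] this is [la_i - i + la'_j - j + 1]; the truncated
   subtraction is harmless on cells of the diagram. *)
Definition hook (la : seq nat) (u : cell la) : nat :=
  (nth 0 la u.1 + conj_part la u.2 - u.1 - u.2 - 1)%N.

Definition content (la : seq nat) (u : cell la) : int :=
  (u.2 : nat)%:Z - (u.1 : nat)%:Z.

Section ReversePlanePartitions.
Variables la mu : seq nat.

Definition skew_cell : finType := {u : cell la | u \in skew_diagram la mu}.

Definition is_rpp (pi : {ffun skew_cell -> nat}) : bool :=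
  [forall u : skew_cell, forall v : skew_cell,
     ((val u).1 == (val v).1) && ((val u).2 <= (val v).2)%N
       ==> (pi u <= pi v)%N] &&
  [forall u : skew_cell, forall v : skew_cell,
     ((val u).2 == (val v).2) && ((val u).1 <= (val v).1)%N
       ==> (pi u <= pi v)%N].

Definition rpp : choiceType := {f : {ffun skew_cell -> nat} | is_rpp f}.

Definition rpp_size (pi : rpp) : nat := (\sum_(u : skew_cell) val pi u)%N.

Definition rpp_trace (pi : rpp) : nat :=
  (\sum_(u : skew_cell | (val u).1 == (val u).2 :> nat) val pi u)%N.

End ReversePlanePartitions.

Definition rect_fits (la : seq nat) (a b : nat) : bool :=
  [forall i : 'I_a, forall j : 'I_b, young la (val i, val j)].

(* Number of rows of the largest rectangle with [a] rows and [a + k] columns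
   inside the diagram. The bound on [a] only excludes rectangles without cells. *)
Definition max_rect_rows (la : seq nat) (k : int) : nat :=
  \max_(a < (size la).+1 | (0 <= a%:Z + k) && rect_fits la a `|(a%:Z + k)%R|%N) a.

Definition max_rect (la : seq nat) (k : int) : {set cell la} :=
  [set u : cell la | (u.1 < max_rect_rows la k)%N
         & (u.2 : nat)%:Z < (max_rect_rows la k)%:Z + k].

Definition durfee (la : seq nat) : {set cell la} := max_rect la 0.

Definition diag_size (la mu : seq nat) (k : int) : nat :=
  #|[set u in skew_diagram la mu | content u == k]|.

Definition descending_chain (la : seq nat) (A : {set cell la})
    (c : seq (cell la)) : bool :=
  sorted (fun u v : cell la => (u.1 < v.1)%N && (u.2 < v.2)%N) c && all (mem A) c.

Definition pleasant (la mu : seq nat) (S : {set cell la}) : Prop :=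
  S \subset diagram la /\
  forall k : int, 1 - (size la)%:Z <= k <= (head 0%N la)%:Z - 1 ->
    forall c : seq (cell la), descending_chain (S :&: max_rect la k) c ->
      (size c <= diag_size la mu k)%N.

(* Main.v *)
Require Import Defs.
From HB Require Import structures.
From mathcomp Require Import all_boot all_order all_algebra.
From mathcomp Require Import boolp classical_sets cardinality fsbigop.
From mathcomp Require Import zify ring.

(* A reverse plane partition is built from an array of the same shape by adding
   the cells one at a time, each new corner rewriting its diagonal by a local
   growth rule of Burge type. If [c] is the last cell of a diagonal, the entries
   of the array in the rectangle with corner [c] control that diagonal: their
   sum is the sum of the diagonal, and the longest descending chain in their
   support is its number of nonzero entries. Both facts follow cell by cell from
   the growth rule, because the length of the longest chain obeys
   [L(i,j) = max (L(i-1,j), L(i,j-1), L(i-1,j-1) + [A(i,j) > 0])].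
   The hook length of [u] is the number of diagonals whose last cell lies weakly
   south-east of [u], so the size of the reverse plane partition is the sum of
   the array weighted by hook lengths, and its trace is the sum of the array
   over the Durfee square. Finally, since the entries increase along diagonals,
   the partition vanishes on [mu] exactly when each diagonal has at most [s_k]
   nonzero entries, that is, when the support of the array is pleasant. *)

Set Implicit Arguments.
Unset Strict Implicit.
Unset Printing Implicit Defensive.

Import Order.TTheory GRing.Theory Num.Theory.

(* Rows and columns of fillings are numbered from 1; row and column 0 hold the
   zeros used as missing neighbours of boundary cells. *)
Definition filling := nat -> nat -> nat.
Implicit Types (f g A : filling) (D : nat -> nat -> bool).

(** * Fillings, their statistics and the local growth rule *)

Definition border0 f := forall i, f 0 i = 0 /\ f i 0 = 0.

Definition nwmax f i j := maxn (f i.-1 j) (f i j.-1).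
Definition semin f i j := minn (f i.+1 j) (f i j.+1).

(** Cells outside [D] stay free: they hold the array entries not yet processed. *)
Definition rpp_on D f := forall i j, D i j -> nwmax f i j <= f i j.

Fixpoint diag_sum f i j {struct i} :=
  match i, j with i'.+1, j'.+1 => f i j + diag_sum f i' j' | _, _ => 0 end.

Definition pos f : filling := fun i j => (0 < f i j : nat).

Definition rect_sum f a b := \sum_(i < a) \sum_(j < b) f i.+1 j.+1.

(** Given by its recurrence, so that it can be compared with the growth rule cell by cell;
    [chain_len_ge] and [chain_len_attained] tie it to actual chains. *)
Fixpoint chain_len f i : nat -> nat :=
  if i is i'.+1 then
    fix row j := if j is j'.+1 then
      maxn (maxn (chain_len f i' j) (row j')) (chain_len f i' j' + (0 < f i j))
    else 0
  else fun=> 0.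

(* The diagonal of the new corner is rewritten from north-west to south-east,
   starting with the array entry [m] of the corner as carry. An entry keeps
   [min (f, max (N, W) + carry)]; the excess, plus the slack [min (S, E) - f], is
   carried on, and the last carry goes to the corner. *)
Fixpoint carry f m i j {struct i} :=
  match i, j with
  | i'.+1, j'.+1 =>
    semin f i j - f i j + (nwmax f i j + carry f m i' j' - f i j)
  | _, _ => m
  end.

Definition grow a b f : filling := fun i j =>
  if (i + b == j + a) && (i <= a.+1) then
    if i == a.+1 then nwmax f i j + carry f (f i j) a b
    else minn (f i j) (nwmax f i j + carry f (f a.+1 b.+1) i.-1 j.-1)
  else f i j.

(* The carry of the forward rule after the cell [d] steps north-west of (a, b),
   recovered from the new diagonal. *)
Fixpoint uncarry a b g d :=
  if d is d'.+1 then
    let i := a - d' in let j := b - d' in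
    uncarry a b g d' + maxn (g i j) (semin g i j - uncarry a b g d') + g i j
      - semin g i j - nwmax g i j
  else g a.+1 b.+1 - nwmax g a.+1 b.+1.

(** Let [c] be the carry leaving a cell. If the entry [f] was kept, [c >= semin - f]; if it was
    lowered, [c = semin - f]. Either way [f = max (g, semin - c)]. *)
Definition shrink a b g : filling := fun i j =>
  if (i + b == j + a) && (i <= a.+1) then
    if i == a.+1 then uncarry a b g (minn a b)
    else maxn (g i j) (semin g i j - uncarry a b g (a - i))
  else g i j.

Arguments diag_sum : simpl never.
Arguments carry : simpl never.
Arguments chain_len : simpl never.

(** * Recurrences for diagonal sums, carries, rectangle sums and chain lengths *)

Lemma diag_sumS f i j : diag_sum f i.+1 j.+1 = f i.+1 j.+1 + diag_sum f i j.
Proof. by []. Qed.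

Lemma diag_sum_nil f i j : i = 0 \/ j = 0 -> diag_sum f i j = 0.
Proof. by case=> ->; case: i => //; case: j. Qed.

Lemma diag_sum_ge f i j : border0 f -> f i j <= diag_sum f i j.
Proof.
move=> f0; case: i => [|i]; first by have [-> _] := f0 j.
by case: j => [|j]; rewrite ?leq_addr //; have [_ ->] := f0 i.+1.
Qed.

Lemma carryS f m i j : carry f m i.+1 j.+1 =
  semin f i.+1 j.+1 - f i.+1 j.+1
    + (nwmax f i.+1 j.+1 + carry f m i j - f i.+1 j.+1).
Proof. by []. Qed.

Lemma carry_nil f m i j : i = 0 \/ j = 0 -> carry f m i j = m.
Proof. by case=> ->; case: i => //; case: j. Qed.

Lemma eq_diag_sum f g i j :
  (forall x y, x + j = y + i -> f x y = g x y) ->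
  diag_sum f i j = diag_sum g i j.
Proof.
elim: i j => [|i IH] [|j] // E; rewrite !diag_sumS E ?IH //; last by lia.
by move=> x y xy; apply: E; lia.
Qed.

(** Inclusion-exclusion, kept additive to match [grow_diag_sum]. *)
Lemma rect_sumS f i j :
  rect_sum f i.+1 j.+1 + rect_sum f i j =
  f i.+1 j.+1 + rect_sum f i.+1 j + rect_sum f i j.+1.
Proof.
rewrite /rect_sum !(big_ord_recr i) /=.
under [X in _ = _ + X]eq_bigr do rewrite big_ord_recr /=.
rewrite !big_split /= !(big_ord_recr j) /=.
under [X in X + _ + _ = _]eq_bigr do rewrite big_ord_recr /=.
rewrite big_split /=; lia.
Qed.

Lemma rect_sum_nil f i j : i = 0 \/ j = 0 -> rect_sum f i j = 0.
Proof.
case=> ->; rewrite /rect_sum ?big_ord0 //.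
by rewrite big1 // => k _; rewrite big_ord0.
Qed.

Lemma chain_lenS f i j : chain_len f i.+1 j.+1 =
  maxn (maxn (chain_len f i j.+1) (chain_len f i.+1 j))
       (chain_len f i j + (0 < f i.+1 j.+1)).
Proof. by []. Qed.

Lemma chain_len_nil f i j : i = 0 \/ j = 0 -> chain_len f i j = 0.
Proof. by case=> ->; case: i => //; case: j. Qed.

(** * Adding a corner: the forward rule *)

Section Corner.
Variables (D : nat -> nat -> bool) (a b : nat).
Hypothesis D_pos : forall i j, D i j -> 0 < i /\ 0 < j.
Hypothesis D_down : forall i j x y,
  D i j -> 0 < x <= i -> 0 < y <= j -> D x y.
Hypothesis D_corner : ~~ D a.+1 b.+1.
Hypothesis D_north : 0 < a -> D a b.+1.
Hypothesis D_west : 0 < b -> D a.+1 b.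

Definition add_cell i j := D i j || (i == a.+1) && (j == b.+1).

Let onD i j : bool := (i + b == j + a) && (i <= a.+1).

(** All three cells lie weakly north-west of the north or the west neighbour of the corner. *)
Lemma D_diag i j : i + b = j + a -> 0 < i <= a -> 0 < j ->
  [/\ D i j, D i.+1 j & D i j.+1].
Proof.
move=> dij li lj.
have De : D a b.+1 by apply: D_north; lia.
have Ds : D a.+1 b by apply: D_west; lia.
by split; [apply: (D_down De)|apply: (D_down Ds)|apply: (D_down De)]; lia.
Qed.

Lemma D_diagF i j : i + b = j + a -> D i j -> i <= a.
Proof.
move=> dij Dij; rewrite leqNgt; apply/negP => lai.
by move/negP: D_corner; apply; apply: (D_down Dij); lia.
Qed.

Section Forward.
Variable f : filling.
Hypotheses (f0 : border0 f) (fD : rpp_on D f).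

(** This sandwich makes the truncated subtraction [semin - f] in the carry exact. *)
Lemma rpp_diag i j : i + b = j + a -> 0 < i <= a -> 0 < j ->
  nwmax f i j <= f i j <= semin f i j.
Proof.
move=> dij li lj; have [D1 D2 D3] := D_diag dij li lj.
have := fD D1; have := fD D2; have := fD D3; rewrite /nwmax /semin /=; lia.
Qed.

Lemma grow_off i j : ~~ onD i j -> grow a b f i j = f i j.
Proof. by rewrite /grow /onD => /negbTE ->. Qed.

Lemma grow_on i j : i + b = j + a -> i <= a ->
  grow a b f i j =
    minn (f i j) (nwmax f i j + carry f (f a.+1 b.+1) i.-1 j.-1).
Proof. by move=> dij li; rewrite /grow ifT ?ifF //; lia. Qed.

Lemma grow_corner :
  grow a b f a.+1 b.+1 = nwmax f a.+1 b.+1 + carry f (f a.+1 b.+1) a b.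
Proof. by rewrite /grow eqxx ifT //; lia. Qed.

Lemma grow_nwmax i j : i + b = j + a -> 0 < i -> 0 < j ->
  nwmax (grow a b f) i j = nwmax f i j.
Proof. by move=> ? ? ?; rewrite /nwmax !grow_off /onD; lia. Qed.

Lemma grow_semin i j : i + b = j + a -> semin (grow a b f) i j = semin f i j.
Proof. by move=> ?; rewrite /semin !grow_off /onD; lia. Qed.

Lemma grow_border0 : border0 (grow a b f).
Proof.
move=> i; have [f0i fi0] := f0 i; have [f00 _] := f0 0.
by split; rewrite /grow ?f0i ?fi0 ?min0n; case: ifP => //; case: ifP => //; lia.
Qed.

Lemma grow_outside i j : ~~ add_cell i j -> grow a b f i j = f i j.
Proof.
move=> nD; have [dij|] := boolP (onD i j); last exact: grow_off.
have [f0i fi0] : f 0 j = 0 /\ f i 0 = 0 by have := f0 i; have := f0 j; tauto.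
case: (posnP i) => [i0|lti].
  by rewrite i0 f0i; have [] := grow_border0 j.
case: (posnP j) => [j0|ltj].
  by rewrite j0 fi0; have [] := grow_border0 i.
case: (ltngtP i a.+1) => [lia1||ia1]; first last.
- have jb : j = b.+1 by move: dij; rewrite /onD; lia.
  by move: nD; rewrite /add_cell ia1 jb !eqxx orbT.
- by move: dij; rewrite /onD; lia.
have dd : i + b = j + a by move: dij; rewrite /onD; lia.
have li : 0 < i <= a by lia.
by move: nD; rewrite /add_cell; have [->] := D_diag dd li ltj.
Qed.

(** On the diagonal, the minimum of [f] and [nwmax + carry] is still at least [nwmax]. Off it, the
    entry is unchanged while its neighbours can only have decreased, the corner being no north or
    west neighbour of a cell of [D]. *)
Lemma grow_rpp : rpp_on add_cell (grow a b f).
Proof.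
move=> i j /orP[Dij|/andP[/eqP-> /eqP->]]; last first.
  by rewrite grow_nwmax ?grow_corner //; lia.
have [i0 j0] := D_pos Dij.
have [/andP[/eqP dij _]|ndij] := boolP (onD i j).
  have lia := D_diagF dij Dij.
  rewrite grow_nwmax // grow_on //.
  have := @rpp_diag i j dij; lia.
rewrite (grow_off ndij); apply: leq_trans (fD Dij).
have G x y : 0 < x <= i -> 0 < y <= j -> grow a b f x y <= f x y.
  move=> lx ly; rewrite /grow; case: ifP => // dxy; case: ifP => [xa|_].
    move/negP: D_corner; case; apply: (D_down Dij); lia.
  exact: geq_minl.
have Z x y : 0 < x <= i -> 0 < y <= j -> x.-1 = 0 -> grow a b f x.-1 y = 0.
  by move=> _ _ ->; have [] := grow_border0 y.
have Z' x y : 0 < x <= i -> 0 < y <= j -> y.-1 = 0 -> grow a b f x y.-1 = 0.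
  by move=> _ _ ->; have [] := grow_border0 x.
rewrite /nwmax.
have := @G i.-1 j; have := @G i j.-1; have := @Z i j; have := @Z' i j; lia.
Qed.

(** By monotonicity everything further north-west on the three diagonals is zero, so there is
    neither slack nor entry to alter the carry except the carry itself passing through. *)
Lemma carry_zero m i j : i + b = j + a -> i <= a ->
  nwmax f i.+1 j.+1 = 0 ->
  [/\ carry f m i j = m, diag_sum (pos f) i j = 0,
      diag_sum (pos f) i j.+1 = 0 & diag_sum (pos f) i.+1 j = 0].
Proof.
elim: i j => [|i IH] [|j] dij li h0.
- by rewrite !diag_sum_nil ?carry_nil; auto.
- rewrite carry_nil; [|by left]; rewrite diag_sumS !diag_sum_nil; auto.
  by move: h0; rewrite /nwmax /pos /=; split; lia.
- rewrite carry_nil; [|by right]; rewrite diag_sumS !diag_sum_nil; auto.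
  by move: h0; rewrite /nwmax /pos /=; split; lia.
have h := @rpp_diag i.+1 j.+1 dij.
have hS : f i.+2 j.+1 = 0 /\ f i.+1 j.+2 = 0.
  by move: h0; rewrite /nwmax /=; lia.
have h1 : nwmax f i.+1 j.+1 = 0 by move: h; rewrite /semin; lia.
have h2 : f i.+1 j.+1 = 0 by move: h; rewrite /semin; lia.
have [||e1 e2 e3 e4] := IH j _ _ h1; try lia.
rewrite carryS !diag_sumS /pos h1 h2 e1 /semin; move: e2 e3 e4 hS; rewrite /pos.
by move=> -> -> -> [-> ->]; split; lia.
Qed.

(** Each cell obeys the balance: old entry + new entry + carry out = carry in + [nwmax] + [semin].
    Summed along the diagonal it telescopes, since [semin] at a cell and [nwmax] at the next one are
    the minimum and maximum of the same two entries. *)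
Lemma grow_diag_sum_aux i j : i + b = j + a -> i <= a ->
  diag_sum (grow a b f) i j + diag_sum f i j + carry f (f a.+1 b.+1) i j =
  diag_sum f i j.+1 + diag_sum f i.+1 j + f a.+1 b.+1
   - nwmax f i.+1 j.+1.
Proof.
elim: i j => [|i IH] [|j] dij li.
- rewrite !diag_sum_nil ?carry_nil; auto.
  by have := f0 1; rewrite /nwmax /=; lia.
- rewrite carry_nil; [|by left]; rewrite diag_sumS !diag_sum_nil; auto.
  by have := f0 j.+2; rewrite /nwmax /=; lia.
- rewrite carry_nil; [|by right]; rewrite diag_sumS !diag_sum_nil; auto.
  by have := f0 i.+2; rewrite /nwmax /=; lia.
have h := @rpp_diag i.+1 j.+1 dij.
have {IH} := IH j; rewrite carryS !diag_sumS grow_on //= => IH.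
(* Makes the truncated subtraction in the induction hypothesis exact. *)
have IHm : nwmax f i.+1 j.+1 <= diag_sum f i j.+1 + diag_sum f i.+1 j.
  have := diag_sum_ge i j.+1 f0; have := diag_sum_ge i.+1 j f0.
  by rewrite /nwmax /=; lia.
move: h IH IHm; rewrite /semin /nwmax /=. lia.
Qed.

Lemma grow_diag_sum :
  diag_sum (grow a b f) a.+1 b.+1 + diag_sum f a b =
  diag_sum f a b.+1 + diag_sum f a.+1 b + f a.+1 b.+1.
Proof.
have := @grow_diag_sum_aux a b (addnC a b) (leqnn a).
have := diag_sum_ge a b.+1 f0; have := diag_sum_ge a.+1 b f0.
rewrite diag_sumS grow_corner /nwmax /=; lia.
Qed.

Lemma grow_diag_pos0 i j : i + b = j + a -> i <= a ->
  diag_sum (pos f) i j = 0 -> diag_sum (pos (grow a b f)) i j = 0.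
Proof.
elim: i j => [|i IH] [|j] dij li; [by []|by []|by []|].
rewrite !diag_sumS => /eqP; rewrite addn_eq0 => /andP[/eqP fe /eqP e].
by rewrite IH; [move: fe; rewrite /pos grow_on|..]; lia.
Qed.

(** The successor stands for the next diagonal cell, whose new entry is positive because its [nwmax]
    is. Where [nwmax] is positive, one more step adds 1 to all the counts; where it vanishes,
    [carry_zero] leaves a single cell to inspect. *)
Lemma grow_diag_pos_aux i j : i + b = j + a -> i <= a ->
  0 < nwmax f i.+1 j.+1 ->
  (diag_sum (pos (grow a b f)) i j).+1 =
  maxn (maxn (diag_sum (pos f) i j.+1) (diag_sum (pos f) i.+1 j))
       (diag_sum (pos f) i j + (0 < f a.+1 b.+1)).
Proof.
elim: i j => [|i IH] [|j] dij li.
- rewrite !diag_sum_nil; auto.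
  by have := f0 1; rewrite /nwmax /=; lia.
- rewrite diag_sumS !diag_sum_nil; auto.
  by have := f0 j.+2; rewrite /nwmax /pos /=; lia.
- rewrite diag_sumS !diag_sum_nil; auto.
  by have := f0 i.+2; rewrite /nwmax /pos /=; lia.
have h := @rpp_diag i.+1 j.+1 dij.
have G : pos (grow a b f) i.+1 j.+1 = (0 < minn (f i.+1 j.+1)
   (nwmax f i.+1 j.+1 + carry f (f a.+1 b.+1) i j)) by rewrite /pos grow_on.
have {IH} := IH j; rewrite !diag_sumS G {G}.
have [n0|] := posnP (nwmax f i.+1 j.+1).
  have [||-> d0 d1 d2] := @carry_zero (f a.+1 b.+1) i j _ _ n0; try lia.
  have gd0 : diag_sum (pos (grow a b f)) i j = 0.
    by apply: grow_diag_pos0 d0; lia.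
  by move: h n0; rewrite d0 d1 d2 gd0 /semin /nwmax /pos /=; lia.
move=> n0 IH _.
have [[f1 f2 f3] le_ij] : [/\ 0 < f i.+1 j.+1, 0 < f i.+1 j.+2 & 0 < f i.+2 j.+1]
    /\ i <= a by move: h n0; rewrite /semin /nwmax; split; [split|]; lia.
have dij' : i + b = j + a by lia.
rewrite /= in IH; have {}IH := IH dij' le_ij isT.
rewrite leq_min f1 addn_gt0 n0 /pos f1 f2 f3; rewrite /pos in IH.
by rewrite !add1n IH -!maxnSS addSn.
Qed.

Lemma grow_diag_pos :
  diag_sum (pos (grow a b f)) a.+1 b.+1 =
  maxn (maxn (diag_sum (pos f) a b.+1) (diag_sum (pos f) a.+1 b))
       (diag_sum (pos f) a b + (0 < f a.+1 b.+1)).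
Proof.
rewrite diag_sumS {1}/pos grow_corner.
have [n0|n0] := posnP (nwmax f a.+1 b.+1); last first.
  by rewrite -grow_diag_pos_aux //; lia.
have [-> d0 d1 d2] := carry_zero (f a.+1 b.+1) (addnC a b) (leqnn a) n0.
rewrite d0 d1 d2 n0.
rewrite (grow_diag_pos0 (addnC a b) (leqnn a) d0).
lia.
Qed.

(** The balance at a cell, solved for the carry in. *)
Lemma uncarryE d : d <= minn a b ->
  uncarry a b (grow a b f) d = carry f (f a.+1 b.+1) (a - d) (b - d).
Proof.
elim: d => [|d IH] ld.
  by rewrite /= grow_corner grow_nwmax ?subn0 //; lia.
have [i ai] : exists i, a - d = i.+1 by exists (a - d).-1; lia.
have [j bj] : exists j, b - d = j.+1 by exists (b - d).-1; lia.
have dij : i.+1 + b = j.+1 + a by lia.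
have h := @rpp_diag i.+1 j.+1 dij.
have -> : a - d.+1 = i by lia.
have -> : b - d.+1 = j by lia.
rewrite /= (IH (ltnW ld)) ai bj.
rewrite grow_semin ?grow_nwmax ?grow_on ?carryS /=; lia.
Qed.

Lemma growK : shrink a b (grow a b f) = f.
Proof.
apply/funext => i; apply/funext => j; rewrite /shrink; case: ifPn; last first.
  exact: grow_off.
move=> /andP[/eqP dij li]; case: eqP => [ia|ia].
  have jb : j = b.+1 by lia.
  rewrite ia jb uncarryE // carry_nil //; lia.
case: (posnP i) => [i0|ltia].
  rewrite i0 /semin.
  have [-> _] := grow_border0 j; have [-> _] := grow_border0 j.+1.
  by have [-> _] := f0 j; lia.
case: (posnP j) => [j0|ltj].
  rewrite j0 /semin.
  have [_ ->] := grow_border0 i; have [_ ->] := grow_border0 i.+1.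
  by have [_ ->] := f0 i; lia.
rewrite uncarryE; last by lia.
rewrite grow_semin // grow_on //; last by lia.
case: i j ltia ltj dij li ia => [|i] [|j] // _ _ dij li ia.
have -> : a - (a - i.+1) = i.+1 by lia.
have -> : b - (a - i.+1) = j.+1 by lia.
have h := @rpp_diag i.+1 j.+1 dij.
rewrite carryS /=; lia.
Qed.

End Forward.

(** * Removing a corner: the inverse rule *)

Section Backward.
Variable g : filling.
Hypotheses (g0 : border0 g) (gD : rpp_on add_cell g).

Lemma rpp_diag_add i j : i + b = j + a -> 0 < i <= a -> 0 < j ->
  nwmax g i j <= g i j <= semin g i j.
Proof.
move=> dij li lj; have [D1 D2 D3] := D_diag dij li lj.
have A x y : D x y -> add_cell x y by rewrite /add_cell => ->.
have := gD (A _ _ D1); have := gD (A _ _ D2); have := gD (A _ _ D3).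
by rewrite /nwmax /semin /=; lia.
Qed.

Lemma shrink_off i j : ~~ onD i j -> shrink a b g i j = g i j.
Proof. by rewrite /shrink /onD => /negbTE ->. Qed.

Lemma shrink_on i j : i + b = j + a -> i <= a ->
  shrink a b g i j = maxn (g i j) (semin g i j - uncarry a b g (a - i)).
Proof. by move=> dij li; rewrite /shrink ifT ?ifF //; lia. Qed.

Lemma shrink_corner : shrink a b g a.+1 b.+1 = uncarry a b g (minn a b).
Proof. by rewrite /shrink eqxx ifT //; lia. Qed.

Lemma shrink_nwmax i j : i + b = j + a -> 0 < i -> 0 < j ->
  nwmax (shrink a b g) i j = nwmax g i j.
Proof. by move=> ? ? ?; rewrite /nwmax !shrink_off /onD; lia. Qed.

Lemma shrink_semin i j : i + b = j + a ->
  semin (shrink a b g) i j = semin g i j.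
Proof. by move=> ?; rewrite /semin !shrink_off /onD; lia. Qed.

Lemma shrink_border0 : border0 (shrink a b g).
Proof.
move=> i; have [g0i gi0] := g0 i; have [g01 g10] := g0 i.+1.
by split; rewrite /shrink /semin ?g0i ?gi0 ?g01 ?g10; case: ifP => //;
  case: ifP => //; lia.
Qed.

Lemma shrink_outside i j : ~~ add_cell i j -> shrink a b g i j = g i j.
Proof.
move=> nD; have [dij|] := boolP (onD i j); last exact: shrink_off.
have [g0i gi0] : g 0 j = 0 /\ g i 0 = 0 by have := g0 i; have := g0 j; tauto.
case: (posnP i) => [i0|lti].
  by rewrite i0 g0i; have [] := shrink_border0 j.
case: (posnP j) => [j0|ltj].
  by rewrite j0 gi0; have [] := shrink_border0 i.
case: (ltngtP i a.+1) => [lia1||ia1].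
- have dd : i + b = j + a by move: dij; rewrite /onD; lia.
  have li : 0 < i <= a by lia.
  by move: nD; rewrite /add_cell; have [->] := D_diag dd li ltj.
- by move: dij; rewrite /onD; lia.
have jb : j = b.+1 by move: dij; rewrite /onD; lia.
by move: nD; rewrite /add_cell ia1 jb !eqxx orbT.
Qed.

(** Entries on the diagonal can only increase, but never beyond [semin], so their south and east
    neighbours in [D] still dominate them. *)
Lemma shrink_rpp : rpp_on D (shrink a b g).
Proof.
move=> i j Dij; have [i0 j0] := D_pos Dij.
have DA : add_cell i j by rewrite /add_cell Dij.
have [/andP[/eqP dij _]|ndij] := boolP (onD i j).
  have lia := D_diagF dij Dij.
  rewrite shrink_nwmax // shrink_on //.
  by have := @rpp_diag_add i j dij; lia.
rewrite (shrink_off ndij).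
have G x y : 0 < x <= i -> 0 < y <= j ->
    x.+1 = i /\ y = j \/ x = i /\ y.+1 = j ->
    shrink a b g x y <= g i j.
  move=> lx ly xy; have [/andP[/eqP dxy xa]|nxy] := boolP (onD x y); last first.
    rewrite shrink_off //; apply: leq_trans (gD DA).
    by case: xy => -[<- <-]; rewrite /nwmax /=; lia.
  have {}xa : x <= a.
    rewrite leqNgt; apply/negP => ax; move/negP: D_corner; apply.
    by apply: (D_down Dij); lia.
  rewrite shrink_on //; have := @rpp_diag_add x y dxy; rewrite /semin.
  by case: xy => -[<- <-]; lia.
have Z : shrink a b g 0 j = 0 by have [] := shrink_border0 j.
have Z' : shrink a b g i 0 = 0 by have [] := shrink_border0 i.
rewrite /nwmax; case: i j i0 j0 {Dij DA ndij} G Z Z' => [|i] [|j] // _ _ G Z Z'.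
rewrite /= geq_max; apply/andP; split.
- by case: i Z {Z'} G => [-> //|i] _ G; apply: G; lia.
by case: j Z' {Z} G => [-> //|j] _ G; apply: G; lia.
Qed.

Lemma shrink_carry d : d <= minn a b ->
  carry (shrink a b g) (shrink a b g a.+1 b.+1) (a - d) (b - d) =
  uncarry a b g d.
Proof.
(* Induction from the north-west end of the diagonal, where the carry is the array entry itself,
   towards the corner. *)
move=> ld; have [k] := ubnP (minn a b - d); elim: k d ld => // k IH d ld lk.
case: (ltngtP d (minn a b)) ld => // [{}ld|->] _; last first.
  by rewrite shrink_corner carry_nil //; lia.
have {}IH := IH d.+1 ld.
have [i ai] : exists i, a - d = i.+1 by exists (a - d).-1; lia.
have [j bj] : exists j, b - d = j.+1 by exists (b - d).-1; lia.
have dij : i.+1 + b = j.+1 + a by lia.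
have h := @rpp_diag_add i.+1 j.+1 dij.
have {IH} : carry (shrink a b g) (shrink a b g a.+1 b.+1) i j =
            uncarry a b g d.+1.
  by rewrite -IH; [congr carry; lia|lia].
rewrite /= ai bj carryS => ->.
rewrite shrink_semin ?shrink_nwmax ?shrink_on //; last by lia.
by have -> : a - i.+1 = d; lia.
Qed.

Lemma shrinkK : grow a b (shrink a b g) = g.
Proof.
apply/funext => i; apply/funext => j; rewrite /grow; case: ifPn; last first.
  exact: shrink_off.
move=> /andP[/eqP dij li]; case: eqP => [ia|ia].
  have jb : j = b.+1 by lia.
  have := @shrink_carry 0 isT; rewrite ia jb !subn0 => -> /=.
  rewrite shrink_nwmax //; last by lia.
  have : add_cell a.+1 b.+1 by rewrite /add_cell !eqxx orbT.
  by move/gD; lia.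
case: (posnP i) => [i0|ltia].
  rewrite i0; have [-> _] := shrink_border0 j.
  by have [-> _] := g0 j; rewrite min0n.
case: (posnP j) => [j0|ltj].
  rewrite j0; have [_ ->] := shrink_border0 i.
  by have [_ ->] := g0 i; rewrite min0n.
case: i j ltia ltj dij li ia => [|i] [|j] // _ _ dij li ia.
have h := @rpp_diag_add i.+1 j.+1 dij.
rewrite shrink_on ?shrink_nwmax //=; last by lia.
have := @shrink_carry (a - i); have -> : a - (a - i) = i by lia.
have -> : b - (a - i) = j by lia.
have -> : a - i = (a - i.+1).+1 by lia.
move=> -> /=; last by lia.
have -> : a - (a - i.+1) = i.+1 by lia.
have -> : b - (a - i.+1) = j.+1 by lia.
lia.
Qed.

End Backward.
End Corner.

(** * Shapes built corner by corner, and the bijection on them *)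

Inductive is_shape : (nat -> nat -> bool) -> Prop :=
| is_shape0 : is_shape (fun _ _ => false)
| is_shapeS D a b : is_shape D -> ~~ D a.+1 b.+1 -> (0 < a -> D a b.+1) ->
    (0 < b -> D a.+1 b) -> is_shape (add_cell D a b).

Lemma shape_pos D i j : is_shape D -> D i j -> 0 < i /\ 0 < j.
Proof.
by elim=> // {}D a b _ IH _ _ _ /orP[/IH//|/andP[/eqP-> /eqP->]].
Qed.

Lemma shape_down D i j x y : is_shape D -> D i j -> 0 < x <= i -> 0 < y <= j ->
  D x y.
Proof.
move=> sD; elim: sD i j x y => // {}D a b _ IH _ nD wD i j x y.
rewrite /add_cell => /orP[Dij lx ly|/andP[/eqP-> /eqP->] lx ly].
  by rewrite (IH _ _ _ _ Dij).
case: (ltnP x a.+1) => [xa|xa].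
  by rewrite (IH a b.+1) //; [apply: nD|]; lia.
case: (ltnP y b.+1) => [yb|yb].
  by rewrite (IH a.+1 b) //; [apply: wD|]; lia.
by apply/orP; right; lia.
Qed.

(** In a shape, these are the last cells of the diagonals. *)
Definition rim D i j := D i j && ~~ D i.+1 j.+1.

Definition rpp_stats A g i j :=
  diag_sum g i j = rect_sum A i j /\ diag_sum (pos g) i j = chain_len A i j.

(** Rim cells on other diagonals keep their statistics, and [(a, b)] leaves the rim. At the new
    corner both statistics obey the recurrences of [rect_sum] and [chain_len], whose three inputs
    sit at old rim cells or on the border. *)
Lemma grow_stats D a b f A : is_shape D -> ~~ D a.+1 b.+1 ->
  (0 < a -> D a b.+1) -> (0 < b -> D a.+1 b) ->
  border0 f -> rpp_on D f -> f a.+1 b.+1 = A a.+1 b.+1 ->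
  (forall i j, rim D i j -> rpp_stats A f i j) ->
  forall i j, rim (add_cell D a b) i j -> rpp_stats A (grow a b f) i j.
Proof.
move=> sD nc nD wD f0 fD fc st i j.
have dD := fun i j x y => @shape_down D i j x y sD.
have st0 x y : x = 0 \/ y = 0 -> rpp_stats A f x y.
  by move=> xy; rewrite /rpp_stats !diag_sum_nil ?rect_sum_nil ?chain_len_nil.
case/andP; rewrite {1}/add_cell => /orP[Dij|/andP[/eqP-> /eqP->] _].
  rewrite negb_or => /andP[nDij nij].
  have [s1 s2] : rpp_stats A f i j by apply: st; rewrite /rim Dij nDij.
  have E x y : x + j = y + i -> grow a b f x y = f x y.
    move=> xy; rewrite grow_off //; apply/negP => /andP[/eqP dxy xa].
    have dij : i + b = j + a by lia.
    have [i0 j0] := shape_pos sD Dij.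
    have lia := D_diagF dD nc nD wD dij Dij.
    case: (ltngtP i a) lia => // [lia|ia] _.
      have [D1 _ _] : [/\ D i.+1 j.+1, D i.+2 j.+1 & D i.+1 j.+2].
        by apply: (D_diag dD nc nD wD); lia.
      by rewrite D1 in nDij.
    by move: nij; rewrite ia; have -> : j = b; lia.
  split; first by rewrite (eq_diag_sum E).
  by rewrite -s2; apply: eq_diag_sum => x y /E; rewrite /pos => ->.
have sN : rpp_stats A f a b.+1.
  case: (posnP a) => [|a0]; first by move=> a0; apply: st0; left.
  apply: st; rewrite /rim nD //; apply: contra nc => D2.
  by apply: (dD _ _ _ _ D2); lia.
have sW : rpp_stats A f a.+1 b.
  case: (posnP b) => [|b0]; first by move=> b0; apply: st0; right.
  apply: st; rewrite /rim wD //; apply: contra nc => D2.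
  by apply: (dD _ _ _ _ D2); lia.
have sNW : rpp_stats A f a b.
  case: (posnP a) => [|a0]; first by move=> a0; apply: st0; left.
  case: (posnP b) => [|b0]; first by move=> b0; apply: st0; right.
  apply: st; rewrite /rim nc andbT; apply: (dD _ _ _ _ (nD a0)); lia.
case: sN sW sNW => [n1 n2] [w1 w2] [m1 m2]; split.
  have := grow_diag_sum dD nc nD wD f0 fD; have := rect_sumS A a b.
  by rewrite n1 w1 m1 fc; lia.
by rewrite (grow_diag_pos dD nc nD wD f0 fD) chain_lenS n2 w2 m2 fc.
Qed.

(** Composition of the growth steps. Agreement outside [D] is part of the induction because the next
    corner must still hold its array entry. *)
Theorem shape_bijection D : is_shape D ->
  exists Phi Psi : filling -> filling,
  (forall A, border0 A ->
     [/\ rpp_on D (Phi A), border0 (Phi A), Psi (Phi A) = A,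
         forall i j, ~~ D i j -> Phi A i j = A i j
       & forall i j, rim D i j -> rpp_stats A (Phi A) i j]) /\
  (forall g, border0 g -> rpp_on D g ->
     [/\ border0 (Psi g), Phi (Psi g) = g
       & forall i j, ~~ D i j -> Psi g i j = g i j]).
Proof.
elim=> [|{}D a b sD [Phi [Psi [fwd bwd]]] nc nD wD].
  by exists id, id.
have pD := fun i j => @shape_pos D i j sD.
have dD := fun i j x y => @shape_down D i j x y sD.
exists (grow a b \o Phi), (Psi \o shrink a b); split=> [A A0|g g0 gD] /=.
  have [fD f0 K out st] := fwd A A0; split.
  - exact: (grow_rpp pD dD nc nD wD f0 fD).
  - exact: (grow_border0 nc nD wD f0).
  - by rewrite (growK dD nc nD wD).
  - move=> i j nij; rewrite (grow_outside dD nc nD wD) //; apply: out.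
    by move: nij; rewrite negb_or => /andP[].
  exact: grow_stats (out _ _ nc) st.
have f0 : border0 (shrink a b g) := shrink_border0 nc nD wD g0.
have fD := shrink_rpp pD dD nc nD wD g0 gD.
have [b0 K out] := bwd _ f0 fD; split=> //.
  by rewrite K (shrinkK dD nc nD wD).
move=> i j nij; rewrite out; last by move: nij; rewrite negb_or => /andP[].
exact: (shrink_outside dD nc nD wD).
Qed.

(** * Young diagrams, rims and hook lengths *)

Lemma big_ord_shift n (F : nat -> nat) : F 0 = 0 -> F n = 0 ->
  \sum_(i < n) F i = \sum_(i < n) F i.+1.
Proof.
move=> F0 Fn; have := @big_ord_recl _ 0 addn n (fun i => F i).
rewrite big_ord_recr /= F0 Fn addn0 add0n => ->.
by apply: eq_bigr.
Qed.

Lemma sum_geq n k : \sum_(i < n) (k <= i) = n - k.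
Proof. by elim: n => [|n IH]; rewrite ?big_ord0 // big_ord_recr IH /=; lia. Qed.

Section Diagram.
Variable la : seq nat.
Hypothesis la_part : is_partition la.

Lemma nth_partition i k : i <= k -> nth 0 la k <= nth 0 la i.
Proof.
move=> ik; have [ks|ks] := ltnP k (size la); last by rewrite nth_default.
have /andP[la_s _] := la_part.
have := @sorted_leq_nth _ geq _ _ 0 la la_s i k; apply => //.
- by move=> x y z xy yz; apply: leq_trans yz xy.
- exact: leqnn.
- by rewrite inE (leq_ltn_trans ik).
Qed.

Lemma youngE i j : young la (i, j) = (j < nth 0 la i).
Proof.
rewrite /young inE /=; case: ltnP => //= ki.
by rewrite nth_default.
Qed.

Lemma young_down i j x y : young la (i, j) -> x <= i -> y <= j ->
  young la (x, y).
Proof.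
rewrite !youngE => lj xi yj; apply: leq_ltn_trans yj _.
exact: leq_trans lj (nth_partition xi).
Qed.

Lemma young_box i j : young la (i, j) -> i < size la /\ j < head 0 la.
Proof.
move=> yij; split; first by case/andP: yij.
by rewrite -nth0 -youngE; apply: young_down yij _ _.
Qed.

(* The diagram of [la] with rows and columns numbered from 1, as in [filling]. *)
Definition young1 i j := [&& 0 < i, 0 < j & young la (i.-1, j.-1)].

Lemma shape_young1 : is_shape young1.
Proof.
(* The first [k] rows and the first [p] cells of the next one: the diagram is filled in reading
   order, and [R k p] is constant in [p] past the end of the row. *)
pose R k p := fun i j => young1 i j && ((i <= k) || (i == k.+1) && (j <= p)).
have R00 : R 0 0 = fun _ _ => false.
  apply/funext => i; apply/funext => j; rewrite /R /young1 youngE.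
  by apply/negP; lia.
have Rcol k p : is_shape (R k p) -> is_shape (R k p.+1).
  move=> sR; have [yp|/negbTE yp] := boolP (young la (k, p)); last first.
    suff -> : R k p.+1 = R k p by [].
    apply/funext => i; apply/funext => j; rewrite /R.
    have [/andP[/eqP -> /eqP ->]|] := boolP ((i == k.+1) && (j == p.+1)).
      by rewrite /young1 /= yp.
    by move=> nij; congr andb; apply/idP/idP; lia.
  have -> : R k p.+1 = add_cell (R k p) k p.
    apply/funext => i; apply/funext => j; rewrite /R /add_cell.
    have [/andP[/eqP -> /eqP ->]|nij] := boolP ((i == k.+1) && (j == p.+1)).
      by rewrite /young1 /= yp orbT; lia.
    by rewrite orbF; congr andb; apply/idP/idP; lia.
  apply: is_shapeS => //; first by rewrite /R; apply/negP; lia.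
  - move=> k0; rewrite /R /young1 leqnn k0 /= !andbT.
    by apply: young_down yp _ _; lia.
  - move=> p0; rewrite /R /young1 leqnn eqxx p0 /= orbT andbT.
    by apply: young_down yp _ _; lia.
have Rrow k : is_shape (R k 0) -> is_shape (R k.+1 0).
  move=> s0; have Rp p : is_shape (R k p) by elim: p => // p /Rcol.
  suff -> : R k.+1 0 = R k (nth 0 la k) by [].
  apply/funext => i; apply/funext => j; rewrite /R /young1 youngE.
  apply/idP/idP; last by lia.
  move=> h; have [ik|ik] := leqP i k; first by move: h; lia.
  have ik1 : i = k.+1 by lia.
  by move: h; rewrite ik1 /=; lia.
have -> : young1 = R (size la) 0.
  apply/funext => i; apply/funext => j; rewrite /R.
  apply/idP/andP => [h|[]//]; split => //.
  by case/and3P: h => i0 _ /young_box[]; lia.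
by elim: (size la) => [|k /Rrow//]; rewrite R00; apply: is_shape0.
Qed.

Definition rim_cell (u : cell la) := rim young1 u.1.+1 u.2.+1.

Lemma rim_cellE u : rim_cell u =
  young la (val u.1, val u.2) && ~~ young la (u.1.+1, u.2.+1).
Proof. by []. Qed.

Lemma sum_cell (P : nat -> nat -> bool) (F : nat -> nat -> nat) :
  \sum_(u : cell la | P u.1 u.2) F u.1 u.2 =
  \sum_(i < size la) \sum_(j < head 0 la) if P i j then F i j else 0.
Proof. by rewrite big_mkcond pair_bigA. Qed.

(* Telescoping: [f] is the difference of [diag_sum f] along each diagonal. *)
Lemma sum_rim f :
  \sum_(u in diagram la) f u.1.+1 u.2.+1 =
  \sum_(u | rim_cell u) diag_sum f u.1.+1 u.2.+1.
Proof.
have dE (u : cell la) : (u \in diagram la) = young la (val u.1, val u.2).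
  by rewrite inE.
under eq_bigl do rewrite dE.
(* The sum over north-west neighbours is added to both sides, so that telescoping needs no
   subtraction. *)
apply/eqP; rewrite -(eqn_add2r (\sum_(u : cell la |
   young la (val u.1, val u.2)) diag_sum f u.1 u.2)).
rewrite -big_split /=.
rewrite (@sum_cell (fun i j => young la (i, j)) (diag_sum f)).
pose G i j := if young la (i, j) then diag_sum f i j else 0.
(* Shifting the indices by one is free: [diag_sum] vanishes in row and column 0, and the index past
   the end is outside the diagram. *)
have -> : \sum_(i < size la) \sum_(j < head 0 la) G i j =
          \sum_(i < size la) \sum_(j < head 0 la) G i.+1 j.+1.
  rewrite (@big_ord_shift _ (fun i => \sum_(j < head 0 la) G i j)).
  - apply: eq_bigr => i _; apply: (@big_ord_shift _ (G i.+1)).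
      by rewrite /G diag_sum_nil ?if_same; auto.
    rewrite /G; case: ifP => // /young_box[]; lia.
  - by apply: big1 => j _; rewrite /G diag_sum_nil ?if_same; auto.
  - apply: big1 => j _; rewrite /G; case: ifP => // /young_box[]; lia.
rewrite pair_bigA /= -big_mkcond /=.
apply/eqP.
rewrite [in RHS]addnC.
rewrite [LHS](bigID (fun u : cell la => young la (u.1.+1, u.2.+1))) /=.
congr (_ + _); apply: eq_bigl => u.
apply/andP/idP => [[]//|h]; split => //.
exact: young_down h _ _.
Qed.

(** [sum_rim] for [f] restricted to the diagonal of [u]: that diagonal has no other rim cell. *)
Lemma diag_sum_rim f (u : cell la) : rim_cell u ->
  diag_sum f u.1.+1 u.2.+1 =
  \sum_(v in diagram la | v.1 + u.2 == v.2 + u.1) f v.1.+1 v.2.+1.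
Proof.
move=> ru; pose f' x y := if x + u.2 == y + u.1 then f x y else 0.
have Tf' x y :
  diag_sum f' x y = if x + u.2 == y + u.1 then diag_sum f x y else 0.
  elim: x y => [|x IH] [|y]; [by case: ifP|by case: ifP|by case: ifP|].
  rewrite !diag_sumS IH /f' !addSn eqSS; by case: ifP.
have := sum_rim f'; rewrite /f' /=.
under eq_bigr do rewrite !addSn eqSS.
rewrite -big_mkcondr => ->.
rewrite (bigD1 u) //= Tf' !addSn eqSS (addnC u.1 u.2) eqxx big1 ?addn0 // => v.
move=> /andP[rv vu]; rewrite Tf' !addSn eqSS; case: eqP => // cuv.
case/eqP: vu; move: ru rv cuv; rewrite !rim_cellE {Tf' f'}.
case: u v => [u1 u2] [v1 v2] /= /andP[yu nu] /andP[yv nv] e.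
case: (ltngtP v1 u1) => [vu|uv|e1].
- by case/negP: nv; apply: young_down yu _ _; lia.
- by case/negP: nu; apply: young_down yv _ _; lia.
by congr pair; apply: val_inj => /=; lia.
Qed.

Lemma rect_sum_cell f i j : i <= size la -> j <= head 0 la ->
  rect_sum f i j = \sum_(u : cell la | (u.1 < i) && (u.2 < j)) f u.1.+1 u.2.+1.
Proof.
move=> ni mj; rewrite /rect_sum.
rewrite (big_ord_widen _ (fun x => \sum_(y < j) f x.+1 y.+1) ni).
rewrite big_mkcond /=.
rewrite (@sum_cell (fun x y => (x < i) && (y < j)) (fun x y => f x.+1 y.+1)).
apply: eq_bigr => x _; case: ltnP => [xi|xi] /=; last by rewrite big1.
by rewrite (big_ord_widen _ (fun y => f x.+1 y.+1) mj) big_mkcond.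
Qed.

Lemma hook_rim (u : cell la) : u \in diagram la ->
  hook u = \sum_(v | rim_cell v) ((u.1 <= v.1) && (u.2 <= v.2)).
Proof.
case: u => u1 u2; rewrite /hook inE youngE /= => du.
(* [f] is the indicator of the hook, which every diagonal reaching the quadrant
   south-east of the cell meets exactly once. *)
pose f x y :=
  (u1 < x) && (u2 < y) && ((x == u1.+1) || (y == u2.+1)) : nat.
have Tf x y : diag_sum f x y = (u1 < x) && (u2 < y).
  elim: x y => [|x IH] [|y]; [by []|by []|by rewrite ltn0 andbF|].
  by rewrite diag_sumS IH /f; lia.
have := sum_rim f; rewrite [RHS](eq_bigr (fun v : cell la =>
  ((u1 <= v.1) && (u2 <= v.2) : nat))); last by move=> v _; rewrite Tf.
move=> <-.
have dE (v : cell la) : (v \in diagram la) = (v.2 < nth 0 la v.1).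
  by rewrite inE youngE.
under eq_bigl do rewrite dE.
rewrite (@sum_cell (fun i j => j < nth 0 la i) (fun i j => f i.+1 j.+1)) /f.
have box : nth 0 la u1 <= head 0 la.
  by apply: leq_trans (nth_partition (leq0n u1)) _; rewrite nth0.
rewrite (bigD1 u1) //=.
(* The cell and its arm. *)
have -> : \sum_(j < head 0 la) (if j < nth 0 la u1 then
   ((u1 < u1.+1) && (u2 < j.+1) && ((u1.+1 == u1.+1) || (j.+1 == u2.+1)) : nat)
     else 0) = nth 0 la u1 - u2.
  rewrite -big_mkcond /= -(big_ord_widen _ (fun j => ((u1 < u1.+1) && (u2 < j.+1)
    && ((u1.+1 == u1.+1) || (j.+1 == u2.+1)) : nat)) box).
  rewrite (eq_bigr (fun j : 'I__ => (u2 <= j : nat))); last first.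
    by move=> j _; rewrite ltnS leqnn eqxx /= andbT.
  exact: sum_geq.
(* The leg, one cell for each lower row that reaches column [u2]. *)
have -> : \sum_(i < size la | i != u1) \sum_(j < head 0 la)
    (if j < nth 0 la i then
      ((u1 < i.+1) && (u2 < j.+1) && ((i.+1 == u1.+1) || (j.+1 == u2.+1)) : nat)
     else 0) = \sum_(i < size la) ((u1 < i) && (u2 < nth 0 la i)).
  rewrite [RHS](bigD1 u1) //= ltnn add0n; apply: eq_bigr => i iu.
  have {}iu : (i : nat) != u1 by [].
  rewrite (bigD1 u2) //= big1 => [|j ju]; first by case: ifP; lia.
  have {}ju : (j : nat) != u2 by [].
  by case: ifP; lia.
(* Rows [0] to [u1] all reach column [u2]; the other parts counted by [conj_part] form the leg. *)
rewrite /conj_part -sum1_count big_mkcond (big_nth 0) big_mkord.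
have -> : \sum_(i < size la) (if u2 < nth 0 la i then 1 else 0) =
  u1.+1 + \sum_(i < size la) ((u1 < i) && (u2 < nth 0 la i)).
  have E : u1.+1 = \sum_(i < size la) (i <= u1).
    rewrite (eq_bigr (fun i : 'I__ => if i < u1.+1 then 1 else 0)); last first.
      by move=> i _; rewrite ltnS; case: ifP.
    rewrite -big_mkcond -(big_ord_widen _ (fun=> 1) (ltn_ord u1)).
    by rewrite sum1_card card_ord.
  rewrite [X in _ = X + _]E -big_split /=; apply: eq_bigr => i _.
  by case: (leqP i u1) => iu; have := nth_partition iu; case: ifP; lia.
lia.
Qed.
End Diagram.

(** * Rim cells, maximal rectangles and chains *)

Lemma rpp_mono D g i j x y :
  (forall i j x y, D i j -> 0 < x <= i -> 0 < y <= j -> D x y) ->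
  rpp_on D g -> D i j -> 0 < x <= i -> 0 < y <= j -> g x y <= g i j.
Proof.
move=> dD gD; have [n] := ubnP (i + j); elim: n i j => // n IH i j ln Dij lx ly.
have := gD _ _ Dij; rewrite /nwmax geq_max => /andP[gi gj].
have [xi|ix] := ltnP x i.
  apply: leq_trans gi; apply: IH; [lia| |lia|lia].
  by apply: dD Dij _ _; lia.
have [yj|jy] := ltnP y j.
  apply: leq_trans gj; apply: IH; [lia| |lia|lia].
  by apply: dD Dij _ _; lia.
have -> : x = i by lia.
by have -> : y = j by lia.
Qed.

Lemma leq_diag i j x y p q : i + q = j + p -> x + q = y + p ->
  (i <= x) = (j <= y).
Proof. lia. Qed.

Section Rim.
Variable la : seq nat.
Hypothesis la_part : is_partition la.
Implicit Types (u v : cell la) (S : {set cell la}).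

(** Double counting of pairs formed by a cell and a rim cell weakly south-east of it. *)
Lemma size_of_stats A g :
  (forall i j, rim (young1 la) i j -> rpp_stats A g i j) ->
  \sum_(u in diagram la) g u.1.+1 u.2.+1 =
  \sum_(u in diagram la) A u.1.+1 u.2.+1 * hook u.
Proof.
move=> st; rewrite sum_rim //.
transitivity (\sum_(v : cell la | rim_cell v) \sum_(u in diagram la)
    A u.1.+1 u.2.+1 * ((u.1 <= v.1) && (u.2 <= v.2))).
  apply: eq_bigr => v rv; have [-> _] := st _ _ rv.
  rewrite (@rect_sum_cell la) // big_mkcond [RHS]big_mkcond; apply: eq_bigr => u _.
  rewrite !ltnS inE; case: ifP => [/andP[u1 u2]|_]; last by rewrite muln0 if_same.
  rewrite muln1 ifT //; case/andP: rv => rv _.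
  by apply: (young_down la_part) rv _ _.
rewrite exchange_big /=; apply: eq_bigr => u du.
by rewrite -big_distrr hook_rim.
Qed.

Lemma content_eq u v : (content u == content v) = (u.1 + v.2 == u.2 + v.1).
Proof. by rewrite /content; apply/eqP/eqP; lia. Qed.

Lemma rect_fitsE a b : rect_fits la a.+1 b.+1 = young la (a, b).
Proof.
apply/forallP/idP => [h|yab i].
  by have /forallP/(_ ord_max) := h ord_max.
apply/forallP => j; apply: (young_down la_part) yab _ _; exact: leq_ord.
Qed.

(** The south-east corner of a rectangle with [a] rows and [a + k] columns has content [k], so the
    largest one ends at the last cell of that diagonal. *)
Lemma max_rect_rows_rim v : rim_cell v -> max_rect_rows la (content v) = v.1.+1.
Proof.
case: v => v1 v2; rewrite rim_cellE /= => /andP[yv nv].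
have e a : (v1 < a)%N -> `|(a%:Z + content (v1, v2))%R|%N = a - v1 + v2.
  by rewrite /content /=; lia.
apply/eqP; rewrite eqn_leq; apply/andP; split.
  apply/bigmax_leqP => a /andP[_ fits]; rewrite leqNgt; apply/negP => va.
  move: fits; rewrite e; last by lia.
  case: {e} (val a) va => // a' va; rewrite subSn ?addSn ?rect_fitsE; last by lia.
  move=> ya; case/negP: nv; apply: (young_down la_part) ya _ _; lia.
have lv : v1.+1 < (size la).+1 by rewrite ltnS.
apply: (@leq_bigmax_cond _ _ _ (Ordinal lv)) => /=.
rewrite e ?subSnn ?add1n ?rect_fitsE ?yv ?andbT //.
by rewrite /content /=; lia.
Qed.

Lemma in_max_rect v u : rim_cell v ->
  (u \in max_rect la (content v)) = (u.1 <= v.1) && (u.2 <= v.2).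
Proof.
move=> rv; rewrite inE max_rect_rows_rim // /content ltnS; congr andb.
by case: u v {rv} => [u1 u2] [v1 v2] /=; lia.
Qed.

Lemma content_range u :
  (1 - (size la)%:Z <= content u <= (head 0%N la)%:Z - 1)%R.
Proof.
case: u => [[u1 l1] [u2 l2]]; rewrite /content /=; lia.
Qed.

Lemma rim_above i j : young la (i, j) ->
  exists2 v : cell la, rim_cell v & v.1 + j = v.2 + i /\ i <= v.1.
Proof.
move=> yij.
have ex : exists d, young la (i + d, j + d) by exists 0; rewrite !addn0.
have bd d : young la (i + d, j + d) -> d <= size la.
  by case/(young_box la_part); lia.
case: (ex_maxnP ex bd) => d yd max.
have [l1 l2] := young_box la_part yd.
exists (Ordinal l1, Ordinal l2); last by split => /=; lia.
rewrite rim_cellE /= yd /=; apply/negP => yd1.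
have := max d.+1; rewrite !addnS yd1 ltnn => h; by have := h isT.
Qed.

(** The diagonal starts in the first row or in the first column, which is full because parts are
    nonzero. *)
Lemma rim_of_content (k : int) :
  (1 - (size la)%:Z <= k <= (head 0%N la)%:Z - 1)%R ->
  exists2 v : cell la, rim_cell v & content v = k.
Proof.
move=> rk.
have pos_nth i : i < size la -> 0 < nth 0 la i.
  move=> li; have /andP[_ n0] := la_part; rewrite lt0n.
  by apply: contra n0 => /eqP e; rewrite -e mem_nth.
have [k0|k0] := boolP (0 <= k)%R.
  have y : young la (0, `|k|%N) by rewrite youngE nth0; lia.
  have [v rv [e _]] := rim_above y; exists v => //.
  by rewrite /content; move: e; lia.
have y : young la (`|k|%N, 0) by rewrite youngE pos_nth; lia.
have [v rv [e _]] := rim_above y; exists v => //.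
by rewrite /content; move: e; lia.
Qed.

Section Chains.
Variables (A : filling) (S : {set cell la}).
Hypothesis SA : forall u, (u \in S) = (0 < A u.1.+1 u.2.+1).

Lemma chain_len_mono i j x y : x <= i -> y <= j ->
  chain_len A x y <= chain_len A i j.
Proof.
have mr : forall i j, chain_len A i j <= chain_len A i j.+1.
  by case=> [|i'] j' //; rewrite chain_lenS; lia.
have mc : forall i j, chain_len A i j <= chain_len A i.+1 j.
  by move=> i' [|j']; rewrite ?chain_lenS; [case: i'|lia].
move=> xi yj; apply: leq_trans (_ : chain_len A i y <= _).
  by rewrite -(subnK xi); elim: (i - x) => // n IH; apply: leq_trans IH (mc _ _).
by rewrite -(subnK yj); elim: (j - y) => // n IH; apply: leq_trans IH (mr _ _).
Qed.

(** Induction from the end of the chain: its last cell supplies the diagonal term of the recurrence,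
    and the rest lies strictly north-west. *)
Lemma chain_len_ge (R : {set cell la}) i j c :
  (forall u, u \in R -> (u.1 < i) && (u.2 < j)) ->
  descending_chain (S :&: R) c -> size c <= chain_len A i j.
Proof.
case/lastP: c => // c v Rij dc.
have {Rij} dv : (v.1 < i) && (v.2 < j).
  apply: Rij; case/andP: dc => _; rewrite all_rcons => /andP[].
  by rewrite /= inE => /andP[].
case/andP: dv => v1 v2; apply: leq_trans (chain_len_mono v1 v2) => {v1 v2}.
elim/last_ind: c v dc => [|c w IH] v dc.
  have vS : v \in S by case/andP: dc => _ /=; rewrite inE => /andP[/andP[]].
  by rewrite chain_lenS -SA vS /=; lia.
have [wv {}dc vS] : [/\ (w.1 < v.1) && (w.2 < v.2),
    descending_chain (S :&: R) (rcons c w) & v \in S].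
  move: dc; rewrite /descending_chain all_rcons => /andP[so /andP[vS al]].
  move: vS; rewrite /= inE => /andP[vS _]; split=> //; last rewrite al andbT.
    move: so; case: c {al IH} => [|x c]; rewrite /= ?andbT //.
    by rewrite !rcons_path last_rcons => /andP[].
  by move: so; case: c {al IH} => [|x c] //=; rewrite rcons_path => /andP[].
case/andP: wv => w1 w2; rewrite size_rcons.
apply: (@leq_trans (chain_len A v.1 v.2 + 1)).
  by rewrite addn1 ltnS; apply: leq_trans (IH _ dc) (chain_len_mono w1 w2).
by rewrite chain_lenS -SA vS leq_max leqnn orbT.
Qed.

(** Backtracking through the recurrence; the cell [w] is appended when the diagonal term alone
    attains the maximum. *)
Lemma chain_len_attained i j : i <= size la -> j <= head 0 la ->
  exists2 c,
    descending_chain (S :&: [set u : cell la | (u.1 < i) && (u.2 < j)]) c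
           & size c = chain_len A i j.
Proof.
elim: i j => [|i IHi] j li lj; first by exists [::].
elim: j lj => [|j IHj] lj; first by exists [::].
have sub x y c : x <= i.+1 -> y <= j.+1 ->
    descending_chain (S :&: [set u : cell la | (u.1 < x) && (u.2 < y)]) c ->
    descending_chain (S :&: [set u : cell la | (u.1 < i.+1) && (u.2 < j.+1)]) c.
  move=> lx ly /andP[so al]; rewrite /descending_chain so.
  apply: sub_all al => u; rewrite /= !inE => /and3P[-> u1 u2] /=.
  by rewrite (leq_trans u1) ?(leq_trans u2).
have [c1 d1 s1] := IHi j.+1 (ltnW li) lj.
have [c2 d2 s2] := IHj (ltnW lj).
have [c3 d3 s3] := IHi j (ltnW li) (ltnW lj).
pose w : cell la := (Ordinal li, Ordinal lj).
have [wS|wS] := boolP (w \in S); last first.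
  move: wS; rewrite SA /= => /negbTE wS; rewrite chain_lenS wS addn0.
  have l3 : chain_len A i j <= chain_len A i j.+1 by apply: chain_len_mono.
  case: (leqP (chain_len A i j.+1) (chain_len A i.+1 j)) => l12.
    by exists c2; [apply: sub d2; lia|rewrite s2; lia].
  by exists c1; [apply: sub d1; lia|rewrite s1; lia].
have wA : 0 < A i.+1 j.+1 by rewrite SA in wS.
case: (leqP (chain_len A i j + 1)
  (maxn (chain_len A i j.+1) (chain_len A i.+1 j))) => l3.
  case: (leqP (chain_len A i j.+1) (chain_len A i.+1 j)) => l12.
    by exists c2; [apply: sub d2; lia|rewrite s2 chain_lenS wA; lia].
  by exists c1; [apply: sub d1; lia|rewrite s1 chain_lenS wA; lia].
exists (rcons c3 w); last by rewrite size_rcons s3 chain_lenS wA; lia.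
have /andP[so3 al3] := d3.
have /andP[_ al3'] := sub _ _ _ (leqnSn i) (leqnSn j) d3.
rewrite /descending_chain all_rcons al3' /= !inE wS /= !leqnn !andbT.
case: c3 so3 al3 {d3 s3 al3'} => [|x c3] //= so3 /andP[xin al3].
rewrite rcons_path so3 /=.
have : last x c3 \in S :&: [set u : cell la | (u.1 < i) && (u.2 < j)].
  by have := mem_last x c3; rewrite inE => /orP[/eqP->//|/(allP al3)].
by rewrite !inE => /andP[].
Qed.

(** Admissible contents are those of rim cells, and the maximal rectangle is the one cornered at the
    rim cell. *)
Lemma pleasantP mu : S \subset diagram la ->
  pleasant mu S <-> forall v : cell la, rim_cell v ->
    chain_len A v.1.+1 v.2.+1 <= diag_size la mu (content v).
Proof.
move=> Sd; split=> [[_ pl] v rv|h].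
  have [c dc <-] := chain_len_attained (ltn_ord v.1) (ltn_ord v.2).
  apply: pl (content_range v) _ _.
  have -> // : S :&: max_rect la (content v) =
    S :&: [set u : cell la | (u.1 < v.1.+1) && (u.2 < v.2.+1)].
  by congr (_ :&: _); apply/setP => u; rewrite in_max_rect // inE.
split=> // k /rim_of_content[v rv <-] c dc; apply: leq_trans (h v rv).
by apply: chain_len_ge dc => u; rewrite in_max_rect.
Qed.

End Chains.

(** Along a diagonal the cells of [mu] come first and [g] increases. A nonzero entry in [mu] forces
    every entry beyond [mu] to be nonzero, which gives one too many. *)
Lemma diag_sum_pos_le mu g : is_partition mu -> rpp_on (young1 la) g ->
  (forall v : cell la, rim_cell v ->
    diag_sum (pos g) v.1.+1 v.2.+1 <= diag_size la mu (content v)) <->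
  (forall u : cell la, u \in diagram la -> young mu (cell_val u) ->
    g u.1.+1 u.2.+1 = 0).
Proof.
move=> mu_part gD.
have dsE v : diag_size la mu (content v) =
    \sum_(u in diagram la | u.1 + v.2 == u.2 + v.1) ~~ young mu (cell_val u).
  rewrite /diag_size -sum1_card big_mkcond [RHS]big_mkcond; apply: eq_bigr => u _.
  rewrite !inE -content_eq; case: (young la _); rewrite ?andbF //=.
  by case: (_ == _); rewrite ?andbF //= andbT; case: (young mu _).
split=> [h u du mu_u|h v rv].
  apply/eqP; rewrite -leqn0 leqNgt; apply/negP => gu.
  have [v rv ev] := rim_of_content (content_range u).
  have := h v rv; rewrite dsE diag_sum_rim // leqNgt => /negP; apply.
  have cu : u.1 + v.2 == u.2 + v.1 by rewrite -content_eq ev.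
  rewrite (bigD1 u) ?du ?cu //= [X in _ < X](bigD1 u) ?du ?cu //= mu_u /pos gu.
  rewrite add0n add1n ltnS; apply: leq_sum => w /andP[/andP[dw cw] _].
  case: (boolP (young mu _)) => //= muw.
  have le1 : (u.1 <= w.1) = (u.2 <= w.2) := leq_diag (eqP cu) (eqP cw).
  have le2 : (w.1 <= u.1) = (w.2 <= u.2) := leq_diag (eqP cw) (eqP cu).
  have [uw|wu] := leqP u.1 w.1; last first.
    case/negP: muw; have := ltnW wu; rewrite le2.
    exact: (young_down mu_part) mu_u (ltnW wu).
  suff gw : g u.1.+1 u.2.+1 <= g w.1.+1 w.2.+1 by rewrite (leq_trans gu gw).
  apply: (rpp_mono _ gD); rewrite /= ?ltnS ?uw -?le1 //.
    by move=> i j x y; apply: (shape_down (shape_young1 la_part)).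
  by rewrite inE in dw.
rewrite dsE diag_sum_rim //; apply: leq_sum => u /andP[du _].
by rewrite /pos; case: (boolP (young mu _)) => //= [/(h u du)->|_] //; case: posnP.
Qed.

End Rim.

(** * From finite arrays to fillings, and from skew to straight shapes *)

Definition fill la (F : cell la -> nat) : filling := fun i j =>
  \sum_(u : cell la | (u.1.+1 == i) && (u.2.+1 == j)) F u.

Lemma fillE la (F : cell la -> nat) (u : cell la) : fill F u.1.+1 u.2.+1 = F u.
Proof.
rewrite /fill (big_pred1 u) // => v; rewrite !eqSS /=.
Qed.

Lemma fill_border0 la (F : cell la -> nat) : border0 (fill F).
Proof.
by move=> i; split; apply: big_pred0 => u; rewrite ?andbF.
Qed.

Lemma fill_outside la (F : cell la -> nat) :
  (forall u, u \notin diagram la -> F u = 0) ->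
  forall i j, ~~ young1 la i j -> fill F i j = 0.
Proof.
move=> F0 i j nij; rewrite /fill big1 // => u /andP[/eqP ui /eqP uj].
by apply: F0; apply: contra nij; rewrite inE -ui -uj.
Qed.

Lemma fillK la g : is_partition la -> border0 g ->
  (forall i j, ~~ young1 la i j -> g i j = 0) ->
  fill (fun u : cell la => g u.1.+1 u.2.+1) = g.
Proof.
move=> la_part g0 gout; apply/funext => i; apply/funext => j.
have [yij|nij] := boolP (young1 la i j); last first.
  rewrite gout // fill_outside // => u; rewrite inE => nu.
  by apply: gout.
case: i j yij => [|i] [|j] //=; rewrite /young1 /= => yij.
have [li lj] := young_box la_part yij.
exact: (@fillE la (fun u => g u.1.+1 u.2.+1) (Ordinal li, Ordinal lj)).
Qed.

Section Skew.
Variables la mu : seq nat.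
Hypotheses (la_part : is_partition la) (mu_part : is_partition mu).

(** At the rim cell of content 0, the diagonal is the main one and the rectangle is the Durfee
    square. *)
Lemma trace_of_stats A g :
  (forall i j, rim (young1 la) i j -> rpp_stats A g i j) ->
  \sum_(u in diagram la | u.1 == u.2 :> nat) g u.1.+1 u.2.+1 =
  \sum_(u in durfee la) A u.1.+1 u.2.+1.
Proof.
move=> st; have [y0|n0] := boolP (young la (0, 0)); last first.
  have no (u : cell la) : False.
    case: u => u1 [u2 l2]; case/negP: n0; rewrite youngE nth0.
    exact: leq_ltn_trans l2.
  by rewrite !big_pred0 // => u; case: (no u).
have [v rv [e _]] := rim_above la_part y0; rewrite !addn0 in e.
have [sv _] := st _ _ rv.
have cv : content v = 0%R by rewrite /content e GRing.subrr.
rewrite /durfee -cv; under [RHS]eq_bigl do rewrite (in_max_rect la_part) //.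
transitivity (diag_sum g v.1.+1 v.2.+1).
  rewrite diag_sum_rim //; apply: eq_bigl => u.
  by rewrite -e eqn_add2r.
rewrite sv (@rect_sum_cell la) //; exact: eq_bigl.
Qed.

Lemma skew_cellP i j : young la (i, j) -> ~~ young mu (i, j) ->
  exists2 s : skew_cell la mu, (val s).1 = i :> nat & (val s).2 = j :> nat.
Proof.
move=> yij nij; have [li lj] := young_box la_part yij.
have s : (Ordinal li, Ordinal lj) \in skew_diagram la mu.
  by rewrite !inE /cell_val /= yij.
by exists (Sub (Ordinal li, Ordinal lj) s).
Qed.

Lemma skew_cell_young (s : skew_cell la mu) :
  young la (cell_val (val s)) /\ ~~ young mu (cell_val (val s)).
Proof. by have := valP s; rewrite !inE => /andP[]. Qed.

(** Extension by zero: [mu] is closed to the north-west, so the cells added to the skew shape impose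
    only inequalities [0 <= x]. *)
Lemma is_rppP (pi : {ffun skew_cell la mu -> nat}) g : border0 g ->
  (forall u : cell la, u \in diagram la -> young mu (cell_val u) ->
     g u.1.+1 u.2.+1 = 0) ->
  (forall s : skew_cell la mu, g (val s).1.+1 (val s).2.+1 = pi s) ->
  is_rpp pi <-> rpp_on (young1 la) g.
Proof.
move=> g0 gmu gpi; split=> [/andP[rows cols]|gD].
  have G i j x y : young la (i, j) -> x <= i -> y <= j -> x = i \/ y = j ->
      g x.+1 y.+1 <= g i.+1 j.+1.
    move=> yij xi yj xy; have yxy := young_down la_part yij xi yj.
    have [mxy|nxy] := boolP (young mu (x, y)).
      have [lx ly] := young_box la_part yxy.
      have := gmu (Ordinal lx, Ordinal ly); rewrite inE /cell_val /= => -> //.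
    have nij : ~~ young mu (i, j).
      by apply: contra nxy => mij; apply: (young_down mu_part) mij _ _.
    have [s s1 s2] := skew_cellP yij nij.
    have [s' s1' s2'] := skew_cellP yxy nxy.
    have := gpi s; have := gpi s'; rewrite s1 s2 s1' s2' => -> ->.
    case: xy => e.
      move/forallP/(_ s')/forallP/(_ s)/implyP: rows; apply.
      by rewrite -val_eqE /= s1 s1' s2 s2' e eqxx.
    move/forallP/(_ s')/forallP/(_ s)/implyP: cols; apply.
    by rewrite -val_eqE /= s1 s1' s2 s2' e eqxx.
  move=> i j /and3P[i0 j0 yij]; case: i j i0 j0 yij => [|i] [|j] //= _ _ yij.
  rewrite /nwmax /= geq_max; apply/andP; split.
    case: i yij => [|i] yij; first by have [-> _] := g0 j.+1.
    by apply: G; auto.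
  case: j yij => [|j] yij; first by have [_ ->] := g0 i.+1.
  by apply: G; auto.
have M (s s' : skew_cell la mu) : (val s).1 <= (val s').1 ->
    (val s).2 <= (val s').2 -> pi s <= pi s'.
  move=> l1 l2; rewrite -!gpi; apply: (rpp_mono _ gD) => //.
  - by move=> i j x y; apply: (shape_down (shape_young1 la_part)).
  - by have [] := skew_cell_young s'.
apply/andP; split; apply/forallP => s; apply/forallP => s'; apply/implyP.
  by case/andP=> /eqP e l; apply: M; rewrite ?e.
by case/andP=> /eqP e l; apply: M; rewrite ?e.
Qed.

Definition cells_of_skew (pi : {ffun skew_cell la mu -> nat}) : cell la -> nat :=
  fun u => if insub u is Some s then pi s else 0.

Lemma sum_skew g (P : pred (cell la)) :
  (forall u : cell la, u \in diagram la -> young mu (cell_val u) ->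
     g u.1.+1 u.2.+1 = 0) ->
  \sum_(s : skew_cell la mu | P (val s)) g (val s).1.+1 (val s).2.+1 =
  \sum_(u in diagram la | P u) g u.1.+1 u.2.+1.
Proof.
move=> gmu.
rewrite [RHS](bigID (fun u => young mu (cell_val u))) /=.
rewrite [X in _ = X + _]big1 ?add0n; last first.
  move=> u /andP[/andP[du _] mu_u]; exact: gmu.
rewrite -(big_sub_cond (mem (skew_diagram la mu)) P
  (fun u : cell la => g u.1.+1 u.2.+1)) /=.
by apply: eq_bigl => u; rewrite inE andbAC.
Qed.

End Skew.

(** * Pleasant arrays and reverse plane partitions *)

Section Count.
Variables la mu : seq nat.
Hypotheses (la_part : is_partition la) (mu_part : is_partition mu).

Definition supp n (x : {ffun cell la -> 'I_n.+1}) : {set cell la} :=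
  [set u | x u != ord0].

(* Bounding the entries by [n] loses nothing, since hook lengths are positive. *)
Definition pleasant_array n (m : nat) : pred {ffun cell la -> 'I_n.+1} := fun x =>
  [&& `[< pleasant mu (supp x) >], \sum_u x u * hook u == n
    & \sum_(u in durfee la) x u == m].

Lemma hook_gt0 (u : cell la) : u \in diagram la -> 0 < hook u.
Proof.
move=> du; rewrite hook_rim //.
have yu : young la (val u.1, val u.2) by rewrite inE in du.
have [v rv [e uv]] := rim_above la_part yu.
by rewrite (bigD1 v) //= -(leq_diag (addnC u.1 u.2) e) uv.
Qed.

Lemma pleasant_rpp_stats (F : cell la -> nat) g :
  (forall u, u \notin diagram la -> F u = 0) ->
  border0 g -> rpp_on (young1 la) g ->
  (forall i j, rim (young1 la) i j -> rpp_stats (fill F) g i j) ->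
  [/\ pleasant mu [set u | F u != 0] <->
        (forall u : cell la, u \in diagram la -> young mu (cell_val u) ->
          g u.1.+1 u.2.+1 = 0),
      \sum_(u in diagram la) g u.1.+1 u.2.+1 = \sum_u F u * hook u
    & \sum_(u in diagram la | u.1 == u.2 :> nat) g u.1.+1 u.2.+1 =
      \sum_(u in durfee la) F u].
Proof.
move=> F0 g0 gD st; split.
- have SF (u : cell la) :
    (u \in [set u | F u != 0]) = (0 < fill F u.1.+1 u.2.+1).
    by rewrite fillE inE lt0n.
  have Sd : [set u | F u != 0] \subset diagram la.
    by apply/fintype.subsetP => u; rewrite inE; apply: contraR => /F0 ->.
  rewrite (pleasantP la_part SF mu Sd) -(diag_sum_pos_le la_part mu_part gD).
  by split=> h v rv; have [_ e] := st _ _ rv; have := h v rv; rewrite e.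
- rewrite (size_of_stats la_part st) big_mkcond; apply: eq_bigr => u _.
  by rewrite fillE; case: ifPn => // /F0 ->.
- rewrite (trace_of_stats la_part st); apply: eq_bigr => u _; exact: fillE.
Qed.

Lemma pleasant_array_bijection (n m : nat) :
  exists h : {ffun cell la -> 'I_n.+1} -> rpp la mu,
  [/\ {in @pleasant_array n m &, injective h},
      forall x, pleasant_array m x ->
        rpp_size (h x) = n /\ rpp_trace (h x) = m
    & forall pi, rpp_size pi = n -> rpp_trace pi = m ->
        exists2 x, @pleasant_array n m x & h x = pi].
Proof.
have [Phi [Psi [fwd bwd]]] := shape_bijection (shape_young1 la_part).
pose F n (x : {ffun cell la -> 'I_n.+1}) : cell la -> nat := fun u => x u.
have rpp0P : is_rpp [ffun _ : skew_cell la mu => 0].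
  by apply/andP; split; apply/forallP => s; apply/forallP => s';
    rewrite !ffunE implybT.
(* Default value for [insubd], never reached on pleasant arrays by [rA] below. *)
pose rpp0 : rpp la mu := @exist _ (fun x => is_rpp x) _ rpp0P.
pose ph (x : {ffun cell la -> 'I_n.+1}) : {ffun skew_cell la mu -> nat} :=
  [ffun s : skew_cell la mu => Phi (fill (F _ x)) (val s).1.+1 (val s).2.+1].
pose h x : rpp la mu := insubd rpp0 (ph x).
have suppE (x : {ffun cell la -> 'I_n.+1}) :
  supp x = [set u | F _ x u != 0] by [].
have F0 (x : {ffun cell la -> 'I_n.+1}) :
    pleasant mu (supp x) -> forall u, u \notin diagram la -> F n x u = 0.
  move=> [/fintype.subsetP Sd _] u; apply: contraNeq => nu; apply: Sd.
  by rewrite inE.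
have hP x : @pleasant_array n m x ->
    [/\ forall s : skew_cell la mu,
          val (h x) s = Phi (fill (F _ x)) (val s).1.+1 (val s).2.+1,
        rpp_size (h x) = n & rpp_trace (h x) = m].
  case/and3P => /asboolP plA /eqP sA /eqP tA.
  have [gD g0 _ _ st] := fwd _ (fill_border0 (F _ x)).
  have [zmu sz tr] := pleasant_rpp_stats (F0 _ plA) g0 gD st.
  have {}zmu := zmu.1 plA.
  have rA : is_rpp (ph x).
    by apply/(is_rppP la_part mu_part g0 zmu) => // s; rewrite ffunE.
  have vh (s : skew_cell la mu) :
    val (h x) s = Phi (fill (F _ x)) (val s).1.+1 (val s).2.+1.
    by rewrite /h val_insubd rA ffunE.
  split=> //; rewrite /rpp_size /rpp_trace.
    under eq_bigr do rewrite vh.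
    rewrite (sum_skew xpredT zmu) -[RHS]sA -sz.
    by apply: eq_bigl => u; rewrite andbT.
  under eq_bigr do rewrite vh.
  by rewrite (sum_skew (fun u : cell la => u.1 == u.2 :> nat) zmu) -[RHS]tA -tr.
exists h; split=> [x y PA PB hAB|x /hP[]//|pi sz tr].
  have [vA _ _] := hP x PA; have [vB _ _] := hP y PB.
  case/and3P: PA => /asboolP plA _ _; case/and3P: PB => /asboolP plB _ _.
  have [gDA g0A KA outA stA] := fwd _ (fill_border0 (F _ x)).
  have [gDB g0B KB outB stB] := fwd _ (fill_border0 (F _ y)).
  have [zA _ _] := pleasant_rpp_stats (F0 _ plA) g0A gDA stA.
  have [zB _ _] := pleasant_rpp_stats (F0 _ plB) g0B gDB stB.
  (* The two images agree on the skew shape by assumption, and vanish on [mu] by pleasantness and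
     outside [la]; [Psi] then recovers the arrays. *)
  have E : Phi (fill (F _ x)) = Phi (fill (F _ y)).
    apply/funext => i; apply/funext => j.
    have [yij|nij] := boolP (young1 la i j); last first.
      rewrite outA // outB // !fill_outside //; exact: F0.
    case: i j yij => [|i] [|j] //; rewrite /young1 /= => yij.
    have [mij|mij] := boolP (young mu (i, j)).
      have [li lj] := young_box la_part yij.
      have := zA.1 plA (Ordinal li, Ordinal lj).
      have := zB.1 plB (Ordinal li, Ordinal lj).
      by rewrite inE /cell_val /= => -> // ->.
    have [s s1 s2] := skew_cellP la_part yij mij.
    by have := vA s; have := vB s; rewrite s1 s2 hAB => -> ->.
  apply/ffunP => u; apply: val_inj.
  by have := fillE (F _ x) u; rewrite -KA E KB fillE.
(* Surjectivity: [pi] is extended by zero and pulled back through [Psi]. *)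
pose c := cells_of_skew (val pi).
have c0 u : u \notin diagram la -> c u = 0.
  move=> nu; rewrite /c /cells_of_skew; case: insubP => // s + _.
  by rewrite inE (negbTE nu).
have cmu (u : cell la) : u \in diagram la -> young mu (cell_val u) ->
    fill c u.1.+1 u.2.+1 = 0.
  move=> _ mu_u; rewrite fillE /c /cells_of_skew; case: insubP => // s.
  by rewrite inE mu_u andbF.
have cs (s : skew_cell la mu) : fill c (val s).1.+1 (val s).2.+1 = val pi s.
  by rewrite fillE /c /cells_of_skew valK.
have g0 := fill_border0 c.
have gD : rpp_on (young1 la) (fill c).
  by apply/(is_rppP la_part mu_part g0 cmu cs)/(valP pi).
have [A0 K out] := bwd _ g0 gD.
pose a := Psi (fill c); pose G (u : cell la) := a u.1.+1 u.2.+1.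
have fG : fill G = a.
  apply: fillK => // i j nij; rewrite /a out //; apply: fill_outside => //.
have G0 u : u \notin diagram la -> G u = 0.
  by rewrite inE => nu; rewrite /G /a out // fill_outside.
have [_ _ _ _ st] := fwd _ A0; rewrite K -[Psi _]/a -fG in st.
have [zmu sG tG] := pleasant_rpp_stats G0 g0 gD st.
have {}sG : \sum_u G u * hook u = n.
  rewrite -sG -sz /rpp_size; under [RHS]eq_bigr do rewrite -cs.
  by rewrite (sum_skew xpredT cmu); apply: eq_bigl => u; rewrite andbT.
have {}tG : \sum_(u in durfee la) G u = m.
  rewrite -tG -tr /rpp_trace; under [RHS]eq_bigr do rewrite -cs.
  by rewrite (sum_skew (fun u : cell la => u.1 == u.2 :> nat) cmu).
(* One term of a weighted sum equal to [n], with weight at least 1. *)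
have Gn u : G u <= n.
  have [du|/G0->//] := boolP (u \in diagram la).
  rewrite -sG (bigD1 u) //= ; apply: leq_trans (leq_addr _ _).
  by rewrite leq_pmulr // hook_gt0.
pose y : {ffun cell la -> 'I_n.+1} := [ffun u => inord (G u)].
have BG u : y u = G u :> nat by rewrite ffunE inordK // ltnS.
have FB : F _ y = G by apply/funext => u; rewrite /F BG.
have PB : pleasant_array m y.
  apply/and3P; split.
  - by apply/asboolP; rewrite suppE FB; apply/zmu.
  - by under eq_bigr do rewrite BG; rewrite sG.
  - by under eq_bigr do rewrite BG; rewrite tG.
exists y => //; have [vB _ _] := hP y PB.
apply: val_inj; apply/ffunP => s; rewrite vB FB fG /a K; exact: cs.
Qed.

End Count.

(** * Infinite sums as counts, and truncated power series *)

Local Open Scope ring_scope.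

(** [F] is the indicator of the finite set [h(P)], so its sum is a cardinal. *)
Lemma fsbig_count (I : choiceType) (T : finType) (P : pred T) (h : T -> I)
    (F : I -> int) :
  {in P &, injective h} -> (forall x, P x -> F (h x) = 1) ->
  (forall i, F i != 0 -> exists2 x, P x & h x = i) ->
  finite_set [set i | F i != 0]%classic /\
  \sum_(i \in [set: I]%classic) F i = #|P|%:R.
Proof.
move=> hI h1 hF; pose r := [seq h x | x <- enum P].
have r0 i : i \notin r -> F i = 0.
  apply: contraNeq => /hF[x Px <-]; apply: map_f; by rewrite mem_enum.
split.
  apply: (@sub_finite_set _ _ [set` r]%classic); last exact: finite_seq.
  by move=> i /= Fi; apply: contraNT Fi => /r0 ->.
have rU : uniq r.
  by rewrite map_inj_in_uniq ?enum_uniq // => x y; rewrite !mem_enum; apply: hI.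
rewrite (@fsbigE _ _ _ _ _ r _ rU) => [|//|i _]; last exact: r0.
rewrite big_map big_enum_cond /= (eq_bigr (fun=> 1)); last first.
  by move=> x /andP[Px _]; apply: h1.
rewrite -sum1_card natr_sum; apply: eq_bigl => x.
by rewrite in_setT andbT.
Qed.

Section Fps.
Variable R : comNzRingType.

Lemma coefs_fpsXM (f : fps R) n :
  coefs (fpsX R * f) n = if n is n'.+1 then coefs f n' else 0.
Proof.
rewrite coefsM; case: n => [|n]; first by rewrite big_ord1 mul0r.
rewrite !big_ord_recl /= mul0r add0r mul1r subSS subn0 big1 ?addr0 // => i _.
by rewrite mul0r.
Qed.

Lemma coefs_fpsX_exp k n : coefs (fpsX R ^+ k) n = (n == k)%:R.
Proof.
elim: k n => [|k IH] n; first by rewrite expr0 coefs1.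
by rewrite exprS coefs_fpsXM; case: n => // n; rewrite IH.
Qed.

Lemma fpsC_exp (c : R) k : fpsC (c ^+ k) = fpsC c ^+ k.
Proof.
elim: k => // k IH; rewrite !exprS -IH; apply: fpsP => n.
by rewrite coefsCM /=; case: eqP; rewrite ?mulr0.
Qed.

(** Congruence modulo [fpsX R ^+ N]. *)
Definition eq_upto N (f g : fps R) := forall n, (n < N)%N -> coefs f n = coefs g n.

Lemma eq_upto_prod N (I : Type) (r : seq I) (P : pred I) (F G : I -> fps R) :
  (forall i, P i -> eq_upto N (F i) (G i)) ->
  eq_upto N (\prod_(i <- r | P i) F i) (\prod_(i <- r | P i) G i).
Proof.
move=> FG; apply: (big_ind2 (eq_upto N)) => // f f' g g' ff gg n nN.
rewrite !coefsM; apply: eq_bigr => i _; rewrite ff ?gg //.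
  exact: leq_ltn_trans (leq_subr _ _) nN.
exact: leq_ltn_trans (leq_ord i) nN.
Qed.

Lemma eq_upto_sum N (I : Type) (r : seq I) (P : pred I) (F G : I -> fps R) :
  (forall i, P i -> eq_upto N (F i) (G i)) ->
  eq_upto N (\sum_(i <- r | P i) F i) (\sum_(i <- r | P i) G i).
Proof.
move=> FG; apply: (big_ind2 (eq_upto N)) => // f f' g g' ff gg n nN.
by rewrite !coefsD ff ?gg.
Qed.

End Fps.

(** The tail [w ^+ n.+1 / (1 - w)] starts in degree at least [n.+1]. Exponent 0 is absent, so each
    cell of a support gets a positive entry. *)
Lemma eq_upto_geometric (R : comUnitRingType) (w : fps R) n : coefs w 0 = 0 ->
  eq_upto n.+1 (w / (1 - w)) (\sum_(i < n.+1 | i != ord0) w ^+ i).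
Proof.
move=> w0.
have Uw : 1 - w \is a GRing.unit.
  change (coefs (1 - w) 0 \is a GRing.unit).
  by rewrite coefsD coefsN w0 subr0 coefs1 unitr1.
have E : w / (1 - w) = \sum_(i < n.+1 | i != ord0) w ^+ i + w ^+ n.+1 / (1 - w).
  apply: (mulIr Uw); rewrite mulrDl !divrK //.
  have := subrX1 w n.+1; rewrite [in RHS](bigD1 ord0) //= expr0 => e.
  set s := (\sum_(i < _ | _) _) in e *.
  have -> : s * (1 - w) = (w - 1) - (w - 1) * (1 + s) by ring.
  by rewrite -e; ring.
move=> k kn; rewrite E coefsD [X in _ + X](_ : _ = 0) ?addr0 //.
rewrite coefsM big1 // => i _; rewrite coefs_exp_small ?mul0r //.
exact: leq_ltn_trans (leq_ord i) kn.
Qed.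

Lemma coef_qt_monomial a b n m :
  coef_qt (q ^+ a * t ^+ b) n m = ((a == n) && (b == m))%:R.
Proof.
rewrite /coef_qt /q /t -fpsC_exp mulrC coefsCM coefs_fpsX_exp eq_sym.
case: (a == n); rewrite ?mulr0 // mulr1.
by rewrite coefs_fpsX_exp eq_sym.
Qed.

(** * The generating function of pleasant arrays *)

Section Main.
Variables la mu : seq nat.
Hypothesis la_part : is_partition la.

Definition weight (u : cell la) : Zqt :=
  (if u \in durfee la then t else 1) * q ^+ hook u.

Lemma prod_weight n (x : {ffun cell la -> 'I_n.+1}) (S : {set cell la}) :
  (forall u, u \notin S -> x u = ord0) ->
  \prod_(u in S) weight u ^+ x u =
  q ^+ (\sum_u x u * hook u)%N * t ^+ (\sum_(u in durfee la) x u)%N.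
Proof.
move=> xS; rewrite -!prodrXr [X in _ * X]big_mkcond -big_split /=.
rewrite big_mkcond; apply: eq_bigr => u _.
case: ifPn => [_|/xS ->]; last by rewrite mul0n !expr0 if_same mulr1.
rewrite /weight exprMn -exprM mulnC mulrC; congr (_ * _).
by case: ifP; rewrite ?expr1n.
Qed.

(** For each [S], the product of geometric series expands into the arrays with support exactly [S].
    Entries above [n] only affect powers of [q] beyond [n]. *)
Lemma pleasant_series_upto n :
  eq_upto n.+1
    (\sum_(S : {set cell la} | `[< pleasant mu S >])
       (\prod_(u in S :&: durfee la) (t * q ^+ hook u / (1 - t * q ^+ hook u))) *
       (\prod_(u in S :\: durfee la) (q ^+ hook u / (1 - q ^+ hook u))))
    (\sum_(x : {ffun cell la -> 'I_n.+1} | `[< pleasant mu (supp x) >])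
       q ^+ (\sum_u x u * hook u)%N * t ^+ (\sum_(u in durfee la) x u)%N).
Proof.
rewrite [X in eq_upto _ _ X](partition_big (@supp la n)
  (fun S => `[< pleasant mu S >])) //=.
apply: eq_upto_sum => S /asboolP plS.
have -> : (\prod_(u in S :&: durfee la) (t * q ^+ hook u / (1 - t * q ^+ hook u))) *
   (\prod_(u in S :\: durfee la) (q ^+ hook u / (1 - q ^+ hook u))) =
   \prod_(u in S) (weight u / (1 - weight u)).
  have E (T : {set cell la}) (F : cell la -> Zqt) :
      {in T, forall u, F u = weight u} ->
      \prod_(u in T) (F u / (1 - F u)) = \prod_(u in T) (weight u / (1 - weight u)).
    by move=> FE; apply: eq_bigr => u /FE ->.
  rewrite (E (S :&: durfee la)) => [|u]; last first.
    by rewrite inE /weight => /andP[_ ->].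
  rewrite (E (S :\: durfee la)) => [|u]; last first.
    by rewrite inE /weight => /andP[/negbTE -> _]; rewrite mul1r.
  exact: esym (@big_setID _ _ _ _ S (durfee la) _).
(* Positive hook lengths remove the constant term in [q]. *)
have w0 u : u \in S -> coefs (weight u) 0 = 0.
  move=> uS; have [/fintype.subsetP Sd _] := plS.
  have := hook_gt0 la_part (Sd u uS); rewrite /weight coefsM0 /q coefs_fpsX_exp.
  by case: (hook u) => // h _; rewrite mulr0.
move=> k kn.
rewrite (eq_upto_prod _ (fun u uS => eq_upto_geometric (n := n) (w0 u uS)) kn).
rewrite (big_distr_big_dep ord0) /=; congr coefs; apply: eq_big => x.
  (* Functions equal to [ord0] off [S] and nonzero on [S] are those with support [S]. *)
  apply/pfamilyP/andP => [[xS xn]|[_ /eqP <-]].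
    have -> : supp x = S.
      apply/setP => u; rewrite inE; apply/idP/idP => [xu|/xn//].
      by move/fintype.subsetP: xS; apply; rewrite inE.
    by split; [apply/asboolP|].
  split=> [|u]; last by rewrite inE.
  by apply/fintype.subsetP => u; rewrite !inE.
case/pfamilyP => /fintype.subsetP xS _; apply: prod_weight => u.
by apply: contraNeq => xu; apply: xS; rewrite inE.
Qed.

End Main.

Theorem theorem1p7 (la mu : seq nat)
    (la_part : is_partition la) (mu_part : is_partition mu)
    (mu_la : included mu la) :
  has_sum (fun pi : rpp la mu => q ^+ rpp_size pi * t ^+ rpp_trace pi)
    (\sum_(S : {set cell la} | `[< pleasant mu S >])
       (\prod_(u in S :&: durfee la) (t * q ^+ hook u / (1 - t * q ^+ hook u))) *
       (\prod_(u in S :\: durfee la) (q ^+ hook u / (1 - q ^+ hook u)))).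
Proof.
move=> n m.
have [h [hI hst hsurj]] := pleasant_array_bijection la_part mu_part n m.
(* Both sides are compared coefficientwise: this one counts pleasant arrays, which [h] matches with
   the reverse plane partitions of size [n] and trace [m]. *)
have -> : coef_qt (\sum_(S : {set cell la} | `[< pleasant mu S >])
       (\prod_(u in S :&: durfee la) (t * q ^+ hook u / (1 - t * q ^+ hook u))) *
       (\prod_(u in S :\: durfee la) (q ^+ hook u / (1 - q ^+ hook u)))) n m =
  #|@pleasant_array la mu n m|%:R.
  rewrite /coef_qt (pleasant_series_upto mu la_part (ltnSn n)) !coefs_sum.
  rewrite -sum1_card natr_sum [LHS]big_mkcond [RHS]big_mkcond; apply: eq_bigr => x _.
  have := coef_qt_monomial (\sum_u x u * hook u) (\sum_(u in durfee la) x u) n m.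
  rewrite /coef_qt unfold_in /pleasant_array => ->.
  by case: (`[< _ >]) => //=; case: (_ && _).
apply: (fsbig_count hI) => [x /hst[sx tx]|pi].
  by rewrite coef_qt_monomial sx tx !eqxx.
rewrite coef_qt_monomial pnatr_eq0 eqb0 negbK => /andP[/eqP sz /eqP tr].
exact: hsurj.
Qed.
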